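(* Let $L$ be a Lie algebra (of arbitrary, possibly infinite, dimension) over a field. Suppose that $L$ admits a finite Frobenius group of automorphisms $FH$ with cyclic kernel $F$ and complement $H$ of order $2$, such that the fixed-point subalgebra $C_L(F)=\{l\in L: l^{\varphi}=l \text{ for all }\varphi\in F\}$ is trivial, $C_L(F)=0$, and the fixed-point subalgebra $C_L(H)$ is metabelian (i.e. $[[C_L(H),C_L(H)],[C_L(H),C_L(H)]]=0$). Then the derived length of $L$ is bounded by a constant: there is an absolute constant $C$ (independent of $L$, of the field and of $|F|$) such that $L^{(C)}=0$.
   Context: The derived series is $L^{(0)}=L$, $L^{(i+1)}=[L^{(i)},L^{(i)}]$. For a group $G$ of automorphisms of $L$, $C_L(G)$ denotes the subalgebra of elements fixed by every element of $G$. *)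

(* Defs.v *)
From HB Require Import structures.
From mathcomp Require Import all_boot all_order all_algebra all_fingroup all_solvable.
From mathcomp Require Import frobenius.
Set Implicit Arguments. Unset Strict Implicit. Unset Printing Implicit Defensive.
Import GRing.Theory.
Local Open Scope ring_scope.

Definition is_lie_bracket (K : fieldType) (L : lmodType K) (br : L -> L -> L) : Prop :=
  [/\ (forall (a : K) (x y z : L), br (a *: x + y) z = a *: br x z + br y z),
      (forall (a : K) (x y z : L), br x (a *: y + z) = a *: br x y + br x z),
      (forall x : L, br x x = 0) &
      (forall x y z : L, br x (br y z) + br y (br z x) + br z (br x y) = 0)].

Inductive span_of (K : fieldType) (L : lmodType K) (S : L -> Prop) : L -> Prop :=
  | span_gen x : S x -> span_of S x
  | span_0 : span_of S 0
  | span_add x y : span_of S x -> span_of S y -> span_of S (x + y)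
  | span_scale (a : K) x : span_of S x -> span_of S (a *: x).

Definition bracket_sub (K : fieldType) (L : lmodType K) (br : L -> L -> L)
  (A B : L -> Prop) : L -> Prop :=
  span_of (fun z => exists x y, A x /\ B y /\ z = br x y).

Fixpoint derived (K : fieldType) (L : lmodType K) (br : L -> L -> L)
  (A : L -> Prop) (i : nat) : L -> Prop :=
  match i with
  | 0 => A
  | i'.+1 => bracket_sub br (derived br A i') (derived br A i')
  end.

(* rho is a faithful (right) action of the finite group G on L by Lie algebra
   automorphisms: l^(g h) = (l^g)^h, so G is (isomorphic to) a group of
   automorphisms of L. *)
Definition lie_aut_action (K : fieldType) (L : lmodType K) (br : L -> L -> L)
  (gT : finGroupType) (G : {group gT}) (rho : gT -> L -> L) : Prop :=
  [/\ (forall g, g \in G -> forall (a : K) (x y : L), rho g (a *: x + y) = a *: rho g x + rho g y),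
      (forall g, g \in G -> forall x y : L, rho g (br x y) = br (rho g x) (rho g y)),
      (forall x : L, rho 1%g x = x),
      (forall g h, g \in G -> h \in G -> forall x : L, rho (g * h)%g x = rho h (rho g x)) &
      (forall g h, g \in G -> h \in G -> (forall x : L, rho g x = rho h x) -> g = h)].

Definition fixed_pts (K : fieldType) (L : lmodType K) (gT : finGroupType)
  (rho : gT -> L -> L) (A : {set gT}) : L -> Prop :=
  fun l => forall g, g \in A -> rho g l = l.

(* Main.v *)
Require Import Defs.
From HB Require Import structures.
From mathcomp Require Import all_boot all_order all_algebra all_fingroup all_solvable.
From mathcomp Require Import frobenius.
From mathcomp Require Import all_field ring zify.
Set Implicit Arguments. Unset Strict Implicit. Unset Printing Implicit Defensive.
Import Order.TTheory GRing.Theory Num.Theory.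
Local Open Scope ring_scope.

(** Let [psi] generate the [p']-part of [F], where [p] is the characteristic: it has odd
    order [n] and still no nonzero fixed point.  Over the scalar extension by
    [K[X]/(Phi_n)] the algebra is the sum of the eigenspaces [L_a] of [psi], a grading by
    [Z/n] with [L_0 = 0].  The involution exchanges [L_a] and [L_{-a}], so metabelianity
    of its fixed points yields [[[L_a, L_b], [L_c, L_d]] = 0] whenever no nonempty
    subfamily of [a, b, c, d] has sum [0].

    A set [D] of degrees is eliminable when a term of the derived series whose index
    depends only on [#|D|] lies in the subalgebra generated by the components of degree
    outside [D].  Let [u] and [v] be homogeneous of degrees [w] and [t] with [w + t <> 0],
    in a late term of the derived series.  Write [v] through products [[p_i, q_{t-i}]] and then [u]
    through products [[r_l, s_{w-l}]], where [i] and [l] avoid the boundedly many degrees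
    for which the preceding relation does not apply; this gives [[u, v] = 0], so that term
    of the series is abelian.  A set can be eliminated by removing successively elements
    which are not midpoints of two others.  Diophantine approximation shows that this is
    only obstructed by torsion of bounded exponent; the remaining configurations are
    classified, and when all degrees involved are torsion one eliminates the whole
    torsion subgroup in Kreknin's way. *)

(** * Graded Lie algebras and elimination of degrees *)

Section LieBracket.
Variables (K : fieldType) (L : lmodType K) (br : L -> L -> L).
Hypothesis lie : is_lie_bracket br.

Lemma brDl x y z : br (x + y) z = br x z + br y z.
Proof. by case: lie => h _ _ _; have := h 1 x y z; rewrite !scale1r. Qed.
Lemma brDr x y z : br x (y + z) = br x y + br x z.
Proof. by case: lie => _ h _ _; have := h 1 x y z; rewrite !scale1r. Qed.
Lemma br0l x : br 0 x = 0.
Proof. by apply: (addrI (br 0 x)); rewrite -brDl !addr0. Qed.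
Lemma br0r x : br x 0 = 0.
Proof. by apply: (addrI (br x 0)); rewrite -brDr !addr0. Qed.
Lemma brZl c x y : br (c *: x) y = c *: br x y.
Proof. by case: lie => h _ _ _; have := h c x 0 y; rewrite !addr0 br0l addr0. Qed.
Lemma brZr c x y : br x (c *: y) = c *: br x y.
Proof. by case: lie => _ h _ _; have := h c x y 0; rewrite !addr0 br0r addr0. Qed.
Lemma brNl x y : br (- x) y = - br x y.
Proof. by rewrite -scaleN1r brZl scaleN1r. Qed.
Lemma brC x y : br x y = - br y x.
Proof.
case: lie => _ _ h _; apply/eqP; rewrite -addr_eq0; apply/eqP.
by have := h (x + y); rewrite brDl !brDr !h add0r addr0.
Qed.
Lemma br_jacobi x y z : br x (br y z) = br (br x y) z - br (br x z) y.
Proof.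
case: lie => _ _ _ h; have := h x y z.
rewrite (brC y (br z x)) (brC z (br x y)) (brC z x) brNl opprK => /eqP.
by rewrite subr_eq0 => /eqP <-; rewrite addrK.
Qed.
Lemma br_swap x y z : br (br x y) z = br (br x z) y + br x (br y z).
Proof. by rewrite br_jacobi addrC subrK. Qed.

Definition subspace (S : L -> Prop) :=
  S 0 /\ forall c x y, S x -> S y -> S (c *: x + y).

Lemma subspaceD S x y : subspace S -> S x -> S y -> S (x + y).
Proof. by move=> [_ h] sx sy; have := h 1 x y sx sy; rewrite scale1r. Qed.
Lemma subspaceZ S c x : subspace S -> S x -> S (c *: x).
Proof. by move=> [h0 h] sx; have := h c x 0 sx h0; rewrite addr0. Qed.
Lemma subspaceN S x : subspace S -> S x -> S (- x).
Proof. by move=> hS sx; rewrite -scaleN1r; exact: subspaceZ. Qed.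
Lemma subspaceB S x y : subspace S -> S x -> S y -> S (x - y).
Proof. by move=> hS sx sy; apply: subspaceD => //; apply: subspaceN. Qed.
Lemma subspace_span S : subspace (span_of S).
Proof.
by split=> [|c x y sx sy]; [apply: span_0|apply: span_add => //; apply: span_scale].
Qed.
Lemma span_sub (S T : L -> Prop) x :
  subspace T -> (forall y, S y -> T y) -> span_of S x -> T x.
Proof.
move=> hT hST; elim=> [y /hST //||y z _ hy _ hz|c y _ hy].
- by case: hT.
- exact: subspaceD.
- exact: subspaceZ.
Qed.

Section Graded.
Variable A : comNzRingType.
Implicit Types (M N : A -> L -> Prop) (D : seq A).

Record graded M : Prop := Graded {
  graded_subspace : forall a, subspace (M a);
  graded_br : forall a b x y, M a x -> M b y -> M (a + b) (br x y);
  graded_0 : forall x, M 0 x -> x = 0 }.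

(** The component of degree [a] of the derived algebra of the sum of all [M b]. *)
Definition der M : A -> L -> Prop := fun a =>
  span_of (fun z => exists b x y, M b x /\ M (a - b) y /\ z = br x y).

(** The graded subalgebra generated by the components of degree outside [D], spanned by left-normed
    products of letters. The separate index [c] in [gen_brl] lets degrees be matched up to ring
    identities. *)
Inductive gen D M : A -> L -> Prop :=
| gen_letter a x : a \notin D -> M a x -> gen D M a x
| gen_brl a b c x y :
    c = a + b -> gen D M a x -> b \notin D -> M b y -> gen D M c (br x y)
| gen_zero a : gen D M a 0
| gen_lin a c x y : gen D M a x -> gen D M a y -> gen D M a (c *: x + y).

Definition subfam N M := forall a x, N a x -> M a x.

Lemma subspace_gen D M a : subspace (gen D M a).
Proof. by split; [apply: gen_zero|move=> *; apply: gen_lin]. Qed.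

Lemma gen_sub D M : graded M -> subfam (gen D M) M.
Proof.
move=> [hs hb h0] a x; elim=> {a x} [//|a b c x y -> _ hx _ hy|a|a c x y _ hx _ hy].
- exact: hb.
- by case: (hs a).
- by case: (hs a) => _; apply.
Qed.

(** Induction on the right factor: the Jacobi identity replaces multiplication by [br y s] by
    multiplications by the shorter [y] and by the letter [s]. *)
Lemma gen_br D M a b x y :
  gen D M a x -> gen D M b y -> gen D M (a + b) (br x y).
Proof.
move=> hx hy; elim: hy a x hx => {b y}.
- by move=> b y hb hy a x hx; apply: gen_brl hx hb hy.
- move=> b1 b2 c y s -> hy IH hb2 hs a x hx; rewrite br_jacobi.
  apply: subspaceB; first exact: subspace_gen.
    by apply: gen_brl (IH _ _ hx) hb2 hs; rewrite addrA.
  have hxs : gen D M (a + b2) (br x s) by apply: gen_brl hx hb2 hs.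
  by have := IH _ _ hxs; rewrite addrAC addrA.
- by move=> b a x _; rewrite br0r; apply: gen_zero.
- move=> b c y z _ IHy _ IHz a x hx; rewrite brDr brZr.
  by apply: gen_lin; [apply: IHy|apply: IHz].
Qed.

Lemma graded_gen D M : graded M -> graded (gen D M).
Proof.
move=> hM; split; [exact: subspace_gen|exact: gen_br|].
by move=> x hx; apply: (graded_0 hM); apply: gen_sub hx.
Qed.

Lemma der_sub M : graded M -> subfam (der M) M.
Proof.
move=> [hs hb h0] a x; apply: span_sub => // z [b [u [v [hu [hv ->]]]]].
by have := hb _ _ _ _ hu hv; rewrite addrC subrK.
Qed.

Lemma der_mono M N : subfam N M -> subfam (der N) (der M).
Proof.
move=> hNM a x; apply: span_sub; first exact: subspace_span.
move=> z [b [u [v [hu [hv ->]]]]]; apply: span_gen.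
by exists b, u, v; split; [apply: hNM|split=> //; apply: hNM].
Qed.

Lemma graded_der M : graded M -> graded (der M).
Proof.
move=> hM; split=> [a|a b x y hx hy|x hx].
- exact: subspace_span.
- apply: span_gen; exists a, x, y; do !split=> //; first exact: der_sub hx.
  by rewrite addrAC subrr add0r; apply: der_sub hy.
- by apply: (graded_0 hM); apply: der_sub hx.
Qed.

Lemma graded_iter_der k M : graded M -> graded (iter k der M).
Proof. by move=> hM; elim: k => //= k; apply: graded_der. Qed.

Lemma iter_der_mono k M N : subfam N M -> subfam (iter k der N) (iter k der M).
Proof. by move=> h; elim: k => //= k; apply: der_mono. Qed.

Lemma iter_der_le k l M :
  graded M -> (k <= l)%N -> subfam (iter l der M) (iter k der M).
Proof.
move=> hM /subnK <-; elim: (l - k)%N => [|j IH] a x //.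
by rewrite addSn /= => /(der_sub (graded_iter_der _ hM)) /IH.
Qed.

(* A product in [gen D M] is a combination of products ending in a letter. *)
Lemma der_gen_ind D M (P : A -> L -> Prop) :
  (forall a, subspace (P a)) ->
  (forall a b x y, gen D M a x -> b \notin D -> M b y -> P (a + b) (br x y)) ->
  subfam (der (gen D M)) P.
Proof.
move=> hP hbr a x; apply: span_sub => // z [b [u [v [hu [hv ->]]]]].
suff main c w : gen D M c w -> forall d y, gen D M d y -> P (d + c) (br y w).
  by have := main _ _ hv _ _ hu; rewrite addrC subrK.
elim=> {a b c u v w x z hu hv}.
- by move=> c y hc hy b u hu; apply: hbr.
- move=> a b c y s -> hy IH hb hs d u hu; rewrite br_jacobi; apply: subspaceB => //.
    by rewrite addrA; apply: hbr => //; apply: gen_br.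
  have hus : gen D M (d + b) (br u s) by apply: gen_brl hu hb hs.
  by have := IH _ _ hus; rewrite addrAC addrA.
- by move=> c b u _; rewrite br0r; case: (hP (b + c)).
- move=> d c y z _ IHy _ IHz b u hu; rewrite brDr brZr.
  by case: (hP (b + d)) => _; apply; [apply: IHy|apply: IHz].
Qed.

Definition midpoint_free (e : A) D :=
  forall d1 d2, d1 \in D -> d2 \in D -> d1 + d2 = e + e -> d1 = d2.
Definition reflection_closed (e : A) D := forall d, d \in D -> e - d \in D.

(** The list is consumed from its tail: the head is removed last, and its condition concerns only
    the degrees removed before it. The two alternatives are handled by [midpoint_step] and
    [reflection_step]. *)
Fixpoint eliminable D : Prop :=
  if D is e :: D0 then
    eliminable D0 /\ (midpoint_free e D0 \/ reflection_closed e D0)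
  else True.

(* The letters [y] and the degrees [e - b] of their cofactors both lie outside [e :: D]. *)
Lemma reflection_step M D e :
  graded M -> reflection_closed e D ->
  forall x, der (gen D M) e x -> gen (e :: D) M e x.
Proof.
move=> hM hD x hx.
pose P a x := a = e -> gen (e :: D) M e x.
suff /(_ e x hx erefl) : subfam (der (gen D M)) P by [].
apply: der_gen_ind => {x hx}.
  move=> a; split=> [_|c x y hx hy ea]; first exact: gen_zero.
  by apply: gen_lin; [apply: hx|apply: hy].
move=> a b x y hx hb hy eab.
have hx' := gen_sub hM hx.
have [a0|nza] := eqVneq a 0.
  by move: hx'; rewrite a0 => /(graded_0 hM) ->; rewrite br0l; apply: gen_zero.
have [b0|nzb] := eqVneq b 0.
  by move: hy; rewrite b0 => /(graded_0 hM) ->; rewrite br0r; apply: gen_zero.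
have ae : a = e - b by rewrite -eab addrK.
rewrite -{2}eab; apply: gen_brl (erefl _) _ _ hy.
- apply: gen_letter hx'; rewrite inE negb_or; apply/andP; split.
    by apply: contraNneq nzb => ae'; move: eab; rewrite ae' -{2}[e]addr0 => /addrI ->.
  by apply: contra hb => /hD; rewrite ae subKr.
- rewrite inE negb_or hb andbT.
  by apply: contraNneq nza => be; move: eab; rewrite be -{2}[e]add0r => /addIr ->.
Qed.

(** * Removal of a degree that is not a midpoint *)

Section Midpoint.
Variables (M : A -> L -> Prop) (D : seq A) (e : A).
Hypothesis no_2torsion : forall x : A, x + x = 0 -> x = 0.
Hypothesis hM : graded M.
Hypothesis hD : midpoint_free e D.

Let B := gen (e :: D) M.
(** Left-normed product of [X] with the second components of [ys]; the first components record their
    degrees. *)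
Let lb (X : L) (ys : seq (A * L)) := foldl (fun x p => br x p.2) X ys.
Let deg (ys : seq (A * L)) : A := \sum_(p <- ys) p.1.
Let inB (ys : seq (A * L)) := forall p, p \in ys -> B p.1 p.2.

Let inB_cons p ys : B p.1 p.2 -> inB ys -> inB (p :: ys).
Proof. by move=> hp hys q; rewrite inE => /orP [/eqP ->|/hys]. Qed.
Let inB_tail p ys : inB (p :: ys) -> inB ys.
Proof. by move=> h q hq; apply: h; rewrite inE hq orbT. Qed.
Let inB_head p ys : inB (p :: ys) -> B p.1 p.2.
Proof. by apply; rewrite mem_head. Qed.
Let inB_cat us ys : inB us -> inB ys -> inB (us ++ ys).
Proof. by move=> hu hy q; rewrite mem_cat => /orP [/hu|/hy]. Qed.

Let lbD X Y ys : lb (X + Y) ys = lb X ys + lb Y ys.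
Proof. by elim: ys X Y => //= p ys IH X Y; rewrite brDl IH. Qed.
Let lbZ c X ys : lb (c *: X) ys = c *: lb X ys.
Proof. by elim: ys X => //= p ys IH X; rewrite brZl IH. Qed.
Let lb0 ys : lb 0 ys = 0.
Proof. by elim: ys => //= p ys IH; rewrite br0l. Qed.

Let lbM a X ys : M a X -> inB ys -> M (a + deg ys) (lb X ys).
Proof.
rewrite /deg; elim: ys a X => [|p ys IH] a X hX hys /=; first by rewrite big_nil addr0.
rewrite big_cons addrA; apply: IH; last exact: inB_tail hys.
by apply: (graded_br hM) => //; apply: gen_sub (inB_head hys).
Qed.

Let lbB a X ys : B a X -> inB ys -> B (a + deg ys) (lb X ys).
Proof.
rewrite /deg; elim: ys a X => [|p ys IH] a X hX hys /=; first by rewrite big_nil addr0.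
rewrite big_cons addrA; apply: IH; last exact: inB_tail hys.
by apply: gen_br => //; apply: inB_head hys.
Qed.

(** Transposing [z] with its right neighbour [y] costs a product in which [z] and [y] are merged
    into one factor, hence a shorter one, covered by the last premise. Once [z] is at the end,
    everything before it has the admissible degree [e - z.1] and is a single letter. *)
Let move_last a X pre z ys :
  M a X -> inB pre -> B z.1 z.2 -> inB ys ->
  a + deg pre + z.1 + deg ys = e -> e - z.1 \notin e :: D ->
  (forall us, size us = (size pre + size ys)%N -> us != [::] ->
     inB us -> a + deg us = e -> B e (lb X us)) ->
  B e (lb X (pre ++ z :: ys)).
Proof.
move=> hX; elim: ys pre => [pre hpre hz hys htot hnot hsh|].
  rewrite /lb foldl_cat /= -/(lb X pre).
  have ed : a + deg pre = e - z.1.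
    by rewrite -htot /deg big_nil addr0 addrK.
  rewrite -[e](subrK z.1) -/(B _ _); apply: gen_br => //.
  by apply: gen_letter => //; rewrite -ed; apply: lbM.
move=> y ys IH pre hpre hz hys htot hnot hsh.
have hy := inB_head hys; have {}hys := inB_tail hys.
have split_lb : lb X (pre ++ z :: y :: ys) =
    lb X (rcons pre y ++ z :: ys) + lb X (pre ++ (z.1 + y.1, br z.2 y.2) :: ys).
  by rewrite /lb cat_rcons !foldl_cat /= br_swap -!/(lb _ _) lbD.
rewrite split_lb; apply: subspaceD; first exact: subspace_gen.
- apply: IH => //.
  + by rewrite -cats1; apply: inB_cat => //; apply: inB_cons.
  + by rewrite -htot /deg -cats1 !big_cat !big_cons !big_nil /=; ring.
  + by move=> us; rewrite size_rcons addSnnS; apply: hsh.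
- apply: hsh.
  + by rewrite size_cat.
  + by case: (pre).
  + by apply: inB_cat => //; apply: inB_cons => //; apply: gen_br.
  + by rewrite -htot /deg big_cat !big_cons /=; ring.
Qed.

(** The invariant of the rewriting: [X] may lie outside [B], but its products with elements of [B]
    that arrive at degree [e] do not. The empty product is excluded because [X] may itself be a
    letter of degree [e]. *)
Definition reaches a X := forall ys, ys != [::] -> inB ys ->
  a + deg ys = e -> B e (lb X ys).

Let reaches_B a X : B a X -> reaches a X.
Proof. by move=> hX ys _ hys <-; apply: lbB. Qed.

Let reaches_br a b X z : reaches a X -> B b z -> reaches (a + b) (br X z).
Proof.
move=> hX hz ys hn hys htot.
apply: (hX ((b, z) :: ys)) => //; first exact: inB_cons.
by rewrite -htot /deg big_cons addrA.
Qed.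

(** Otherwise [e] would be the midpoint of [e + c] and [e - c], which are distinct without
    2-torsion. *)
Let shift_out c : c != 0 -> (e + c \notin e :: D) || (e - c \notin e :: D).
Proof.
move=> nzc; rewrite !inE -!negb_and; apply/negP => /andP[].
rewrite -subr_eq0 [e + c - e]addrAC subrr add0r (negPf nzc) /= => h1.
rewrite -subr_eq0 [e - c - e]addrAC subrr add0r oppr_eq0 (negPf nzc) /= => h2.
have /hD := h1 => /(_ _ h2) h; move/eqP: nzc; apply; apply: no_2torsion.
have /addrI : e + c = e - c by apply: h; ring.
by move/eqP; rewrite -addr_eq0 => /eqP.
Qed.

(* Push a letter [v] of degree [e] to the right: either [[v, y]] is an admissible
   letter, or [y] can be moved to the end, where it multiplies an admissible letter. *)
Let reaches_letter a X v : M a X -> reaches a X -> M e v -> reaches (a + e) (br X v).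
Proof.
move=> hX hR hv ys; move: {2}(size ys) (leqnn (size ys)) => t.
elim: t a X hX hR ys => [|t IH] a X hX hR [|z ys] // hsz _ hys htot.
have hz := inB_head hys; have {}hys := inB_tail hys.
have [z0|nz] := eqVneq z.1 0.
  have z20 : z.2 = 0 by apply: (graded_0 hM); rewrite -z0; apply: gen_sub hz.
  by rewrite /lb /= z20 br0r -/(lb _ _) lb0; apply: gen_zero.
have /orP[hn|hn] := shift_out nz.
- rewrite /lb /= br_swap -/(lb _ _) lbD; apply: subspaceD; first exact: subspace_gen.
  + have [ys0|ysn] := eqVneq ys [::].
      have : a + z.1 = 0.
        move: htot; rewrite ys0 /deg big_seq1 addrAC => /eqP.
        by rewrite -subr_eq0 addrK => /eqP.
      move=> az; rewrite ys0 /lb /=.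
      have -> : br X z.2 = 0.
        by apply: (graded_0 hM); rewrite -az; apply: (graded_br hM) => //; apply: gen_sub hz.
      by rewrite br0l; apply: gen_zero.
    apply: (IH (a + z.1)) => //.
    * by apply: (graded_br hM) => //; apply: gen_sub hz.
    * exact: reaches_br.
    * by rewrite -[RHS]htot /deg big_cons; ring.
  + apply: (hR ((e + z.1, br v z.2) :: ys)) => //.
    * apply: inB_cons => //; apply: gen_letter => //.
      by apply: (graded_br hM) => //; apply: gen_sub hz.
    * by rewrite -[RHS]htot /deg !big_cons /=; ring.
- apply: (@move_last (a + e) (br X v) [::]) => //.
  + exact: (graded_br hM).
  + by rewrite -[RHS]htot /deg big_nil big_cons; ring.
  + move=> us hus usn husB husd; apply: (IH a) => //.
    by rewrite hus.
Qed.

Let reaches_single v : M e v -> reaches e v.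
Proof.
move=> hv ys; move: {2}(size ys) (leqnn (size ys)) => t.
elim: t ys => [|t IH] [|z ys] // hsz _ hys htot.
have hz := inB_head hys; have {}hys := inB_tail hys.
have [z0|nz] := eqVneq z.1 0.
  have z20 : z.2 = 0 by apply: (graded_0 hM); rewrite -z0; apply: gen_sub hz.
  by rewrite /lb /= z20 br0r -/(lb _ _) lb0; apply: gen_zero.
have /orP[hn|hn] := shift_out nz.
- have hl : B (e + z.1) (br v z.2).
    apply: gen_letter => //.
    by apply: (graded_br hM) => //; apply: gen_sub hz.
  by have := lbB hl hys; rewrite -addrA; move: htot; rewrite /deg big_cons => ->.
- apply: (@move_last e v [::]) => //.
  + by rewrite -[RHS]htot /deg big_nil big_cons; ring.
  + by move=> us hus usn husB husd; apply: IH => //; rewrite hus.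
Qed.

(** The letters of [gen D M] missing from [B] are those of degree [e]; the two preceding facts
    absorb them, at the start of a product or as a right factor. *)
Let reaches_gen a X : gen D M a X -> reaches a X.
Proof.
elim=> {a X} [a x ha hx|a b c x y -> hx IH hb hy|a|a c x y _ hx _ hy].
- have [ae|nae] := eqVneq a e.
    by rewrite ae in hx *; apply: reaches_single.
  by apply: reaches_B; apply: gen_letter => //; rewrite inE negb_or nae.
- have [be|nbe] := eqVneq b e.
    by rewrite be in hy *; apply: reaches_letter => //; apply: gen_sub hx.
  apply: reaches_br => //; apply: gen_letter => //.
  by rewrite inE negb_or nbe.
- by move=> ys _ _ _; rewrite lb0; apply: gen_zero.
- move=> ys hn hys htot; rewrite lbD lbZ; apply: gen_lin; first exact: hx.
  exact: hy.
Qed.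

Lemma midpoint_step x : der (gen D M) e x -> gen (e :: D) M e x.
Proof.
move=> hx; pose P a x := a = e -> gen (e :: D) M e x.
suff /(_ e x hx erefl) : subfam (der (gen D M)) P by [].
apply: der_gen_ind => {x hx}.
  move=> a; split=> [_|c x y hx hy ea]; first exact: gen_zero.
  by apply: gen_lin; [apply: hx|apply: hy].
move=> a b x y hx hb hy eab.
have [be|nbe] := eqVneq b e.
  have a0 : a = 0 by apply: (addIr e); rewrite add0r -{1}be.
  have -> : x = 0 by apply: (graded_0 hM); rewrite -a0; apply: gen_sub hx.
  by rewrite br0l; apply: gen_zero.
have hyB : B b y by apply: gen_letter => //; rewrite inE negb_or nbe.
apply: (reaches_gen hx (ys := [:: (b, y)])) => //.
- by move=> p; rewrite inE => /eqP ->.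
- by rewrite /deg big_seq1.
Qed.
End Midpoint.

(** The exponent satisfies f(d + 1) = 2 f(d) + 1: f(d) derivations lead into [gen D M], one more
    puts the component of degree [e] into [gen (e :: D) M], and f(d) further ones, applied to this
    new graded family, remove [D] again. *)
Lemma eliminable_gen D M :
  (forall x : A, x + x = 0 -> x = 0) -> graded M -> eliminable D ->
  subfam (iter (2 ^ size D - 1) der M) (gen D M).
Proof.
move=> hA; elim: D M => [|e D IH] M hM /= => [_|[hD he]].
  by move=> a x hx; apply: gen_letter.
have hG := graded_gen D hM; have hB := graded_der hG.
have hBM : subfam (der (gen D M)) M.
  by move=> a x /(der_sub hG) /(gen_sub hM).
have step a x : a \notin D -> der (gen D M) a x -> gen (e :: D) M a x.
  have [->|nae] := eqVneq a e; move=> ha hx.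
    by case: he => he; [apply: midpoint_step|apply: reflection_step].
  by apply: gen_letter; [rewrite inE negb_or nae|apply: hBM].
have genB : subfam (gen D (der (gen D M))) (gen (e :: D) M).
  move=> a x; elim=> {a x} [a x ha hx|a b c x y -> _ hx hb hy|a|a c x y _ hx _ hy].
  - exact: step.
  - by apply: gen_br => //; apply: step.
  - exact: gen_zero.
  - exact: gen_lin.
move=> a x hx; apply: genB; apply: (IH _ hB hD).
have e2 : (2 ^ (size D).+1 - 1 = (2 ^ size D - 1) + (2 ^ size D - 1).+1)%N.
  by rewrite expnS; have := expn_gt0 2 (size D); lia.
rewrite e2 iterD in hx; apply: iter_der_mono hx => b y /=.
by apply: der_mono; apply: IH.
Qed.

(* The elements [p] with [theta [p, M] = 0] form a subalgebra, which contains every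
   component of degree outside [D]. *)
Lemma avoid_degrees D M t (theta : L -> L) s :
  (forall x : A, x + x = 0 -> x = 0) -> graded M -> eliminable D ->
  (size D <= s)%N ->
  (forall c x y, theta (c *: x + y) = c *: theta x + theta y) ->
  (forall i p q, i \notin D -> M i p -> M (t - i) q -> theta (br p q) = 0) ->
  forall x, iter (2 ^ s) der M t x -> theta x = 0.
Proof.
move=> hA hM hD hs hth hpq.
have th0 : theta 0 = 0.
  have := hth (-1) 0 0; rewrite scaler0 add0r scaleN1r => h.
  by rewrite h addNr.
have rad i p : gen D M i p -> forall q, M (t - i) q -> theta (br p q) = 0.
  elim=> {i p} [i p hi hp q hq|a b c x y -> hx IH hb hy q hq|a|a c x y _ hx _ hy].
  - exact: hpq hi hp hq.
  (* The product is rewritten so that [x] and [y] each multiply an element of [M] of the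
     complementary degree. *)
  - rewrite br_swap (brC _ y) -scaleN1r hth (hpq b) ?IH ?scaler0 ?addr0 //.
    + have -> : t - a = b + (t - (a + b)) by ring.
      exact: (graded_br hM).
    + have -> : t - b = a + (t - (a + b)) by ring.
      by apply: (graded_br hM) => //; apply: gen_sub hx.
  - by move=> q _; rewrite br0l.
  - by move=> q hq; rewrite brDl brZl hth hx ?hy // scaler0 addr0.
(* The derivation beyond the [2 ^ s - 1] of [eliminable_gen] writes [x] as a combination of brackets
   whose left factor lies in [gen D M]. *)
move=> x /=; have -> : (2 ^ s = (2 ^ s - 1).+1)%N.
  by have := expn_gt0 2 s; lia.
rewrite iterS.
have hle : (2 ^ size D - 1 <= 2 ^ s - 1)%N by rewrite leq_sub2r // leq_pexp2l.
apply: (span_sub (T := fun x => theta x = 0)).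
  by split=> [|c y z hy hz]; rewrite ?hth ?hy ?hz ?scaler0 ?addr0.
move=> z [b [u [v [hu [hv ->]]]]]; apply: (rad b).
  by apply: eliminable_gen => //; apply: iter_der_le hle _ _ _.
by apply: iter_der_le (leq0n _) _ _ hv.
Qed.
End Graded.
End LieBracket.

(** * Midpoints in cyclic groups of odd order *)

Section Stuck.
Variable p : nat.
Let m := p.+2.
Local Notation A := 'I_p.+2.
Implicit Types S D : {set A}.

Definition stuck S := forall e, e \in S ->
  exists d1 d2, [/\ d1 \in S, d2 \in S, d1 != d2 & d1 + d2 = e + e].

(** A multiple of every positive difference of two numbers in [0, 4^s]; locked so that the factorial
    is never computed. *)
Definition cluster_exp s := locked (4 ^ s)`!.

Let res (q : nat) (d : A) : nat := (q * d) %% m.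

Let res_lt q d : (res q d < m)%N. Proof. by rewrite ltn_mod. Qed.

Let res_eq q d : (res q d)%:Z = q%:Z * d%:Z - ((q * d) %/ m)%N%:Z * m%:Z.
Proof. by have /(congr1 Posz) := divn_eq (q * d) m; rewrite PoszD !PoszM => ->; rewrite addrC addKr. Qed.

Let res_natr q d : (res q d)%:R = d *+ q.
Proof. by rewrite Zp_nat Zp_mulrn; apply: val_inj; rewrite /= modn_mod mulnC. Qed.

Let res_sum (d1 d2 e : A) q : d1 + d2 = e + e ->
  exists k : int, (res q d1)%:Z + (res q d2)%:Z - 2 * (res q e)%:Z = k * m%:Z.
Proof.
move=> /(congr1 val) /= h; rewrite !res_eq.
have /(congr1 Posz) := divn_eq (d1 + d2) m; have /(congr1 Posz) := divn_eq (e + e) m.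
rewrite !PoszD !PoszM h.
move: ((d1 + d2) %/ m)%N%:Z ((e + e) %/ m)%N%:Z ((e + e) %% m)%N%:Z => x y z.
move: ((q * d1) %/ m)%N%:Z ((q * d2) %/ m)%N%:Z ((q * e) %/ m)%N%:Z => a1 a2 a0.
move: (d1%:Z) (d2%:Z) (e%:Z) (m%:Z) (q%:Z) => c1 c2 c0 n u h2 h1.
exists (u * (x - y) - a1 - a2 + 2 * a0).
have hc : c1 + c2 - 2 * c0 = (x - y) * n by rewrite mulrBl; lia.
transitivity (u * (c1 + c2 - 2 * c0) - (a1 + a2 - 2 * a0) * n); first by ring.
by rewrite hc; ring.
Qed.

(* Simultaneous Diophantine approximation: some multiple [q] maps [S] into a short
   interval around [0], where midpoint relations hold in the integers, so the
   elements of [S] on which the representative is maximal form a stuck set. *)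
Lemma stuck_cluster s S : stuck S -> S != set0 -> (#|S| <= s)%N ->
  exists S', [/\ S' \subset S, S' != set0, stuck S' &
    {in S' &, forall d e, d *+ cluster_exp s = e *+ cluster_exp s}].
Proof.
move=> hS /set0Pn[x0 hx0] hs.
(* [f q] records the quarter of [0, m) containing the residue of [q * d] for each [d] in [S];
   indices beyond [#|S|] read the default 0. With 4^s + 1 multipliers and 4^s patterns, two
   multipliers agree. *)
pose f (q : 'I_(4 ^ s).+1) : {ffun 'I_s -> 'I_4} :=
  [ffun i : 'I_s => inord (4 * res q (nth 0 (enum S) i) %/ m)].
have /injectivePn [q1' [q2' neq fq']] : ~~ injectiveb f.
  apply/negP => /injectiveP /leq_card.
  by rewrite card_ffun !card_ord ltnn.
wlog lt12 : q1' q2' neq fq' / (q1' < q2')%N.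
  move=> hw; case: (ltngtP q1' q2') => h; last by rewrite (val_inj h) eqxx in neq.
    exact: (hw q1' q2').
  by apply: (hw q2' q1') => //; rewrite eq_sym.
set q1 : nat := q1' in lt12; set q2 : nat := q2' in lt12.
have close d : d \in S -> (4 * res q1 d %/ m = 4 * res q2 d %/ m)%N.
  move=> hd; have hi : (index d (enum S) < s)%N.
    by apply: leq_trans hs; rewrite cardE index_mem mem_enum.
  have := congr1 (fun g : {ffun 'I_s -> 'I_4} => val (g (Ordinal hi))) fq'.
  rewrite /f !ffunE /= nth_index ?mem_enum // !inordK //.
    by rewrite ltn_divLR // ltn_mul2l res_lt.
  by rewrite ltn_divLR // ltn_mul2l res_lt.
have close4 d : d \in S -> (4 * res q1 d < 4 * res q2 d + m)%N /\ (4 * res q2 d < 4 * res q1 d + m)%N.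
  move=> /close h; have h1 := divn_eq (4 * res q1 d) m; have h2 := divn_eq (4 * res q2 d) m.
  have := ltn_mod (4 * res q1 d) m; have := ltn_mod (4 * res q2 d) m.
  rewrite h in h1; lia.
(* The representative of [(q2 - q1) * d] close to 0, shifted by [m] to stay a natural number. *)
pose r (d : A) : nat := (res q2 d + (m - res q1 d))%N.
have rsum d1 d2 e : d1 \in S -> d2 \in S -> e \in S -> d1 + d2 = e + e ->
    (r d1 + r d2 = r e + r e)%N.
  move=> /close4 [h1 h1'] /close4 [h2 h2'] /close4 [h0 h0'] hsum.
  have [k1 e1] := res_sum q1 hsum; have [k2 e2] := res_sum q2 hsum.
  have l1 := res_lt q1 d1; have l2 := res_lt q1 d2; have l0 := res_lt q1 e.
  (* The defect of the midpoint relation is a multiple of [m], while four terms smaller than m/4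
     bound it strictly below [m]. *)
  have ek : k2 - k1 = 0.
    have hm : `|(k2 - k1) * m%:Z| < m%:Z by rewrite mulrBl -e1 -e2; lia.
    apply/eqP; rewrite -absz_eq0 -leqn0 leqNgt; apply/negP => hk.
    by move: hm; rewrite normrM; nia.
  have ek' : k2 * m%:Z = k1 * m%:Z by move/eqP: ek; rewrite subr_eq0 => /eqP ->.
  by rewrite /r; lia.
case: (arg_maxnP r hx0) => x hx hmax.
exists [set d in S | r d == r x]; split.
- by apply/subsetP => d; rewrite inE => /andP[].
- by apply/set0Pn; exists x; rewrite inE eqxx andbT.
- move=> e; rewrite inE => /andP[he /eqP re].
  have [d1 [d2 [h1 h2 hne hsum]]] := hS _ he.
  exists d1, d2; rewrite !inE h1 h2 hne hsum; split=> //=.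
  + have := hmax _ h1; have := hmax _ h2; have := rsum _ _ _ h1 h2 he hsum.
    by rewrite re => *; apply/eqP; lia.
  + have := hmax _ h1; have := hmax _ h2; have := rsum _ _ _ h1 h2 he hsum.
    by rewrite re => *; apply/eqP; lia.
- move=> d e; rewrite !inE => /andP[hd /eqP rd] /andP[he /eqP re].
  have eq : d *+ (q2 - q1) = e *+ (q2 - q1).
    have h : (res q2 d + res q1 e = res q2 e + res q1 d)%N.
      have := res_lt q1 d; have := res_lt q1 e.
      by move: rd re; rewrite /r; lia.
    rewrite !mulrnBr ?(ltnW lt12) // -!(res_natr _ d) -!(res_natr _ e); apply/eqP.
    by rewrite subr_eq addrAC eq_sym subr_eq -!natrD h.
  have /dvdnP [k ->] : (q2 - q1 %| cluster_exp s)%N.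
    rewrite /cluster_exp -lock; apply: dvdn_fact; rewrite subn_gt0 lt12 /=.
    by have := ltn_ord q2'; rewrite -/q2; lia.
  by rewrite mulnC !mulrnA eq.
Qed.

(** Greedy removal of elements that are not midpoints: the first one removed becomes the head of the
    list, and a nonempty set from which none can be removed is stuck. *)
Lemma eliminable_or_stuck D :
  (exists E : seq A, [/\ eliminable E, size E = #|D| & E =i D]) \/
  exists S, [/\ S \subset D, S != set0 & stuck S].
Proof.
move: {2}(#|D|) (leqnn #|D|) => n; elim: n D => [|n IH] D hn.
  left; exists [::]; split=> // [|x]; first by move: hn; rewrite leqn0 => /eqP.
  by move: hn; rewrite leqn0 cards_eq0 => /eqP ->; rewrite inE.
have [D0|nD] := eqVneq D set0.
  by left; exists [::]; split=> // [|x]; rewrite D0 ?cards0 ?inE.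
pose isfree e := [forall d1 in D, forall d2 in D, (d1 + d2 == e + e) ==> (d1 == d2)].
have [/exists_inP[e he efree]|nfree] := boolP [exists e in D, isfree e].
  have hcard : #|D| = #|D :\ e|.+1 by rewrite (cardsD1 e D) he.
  have [|[E [hE hs hm]]|[S [hS nS sS]]] := IH (D :\ e); first by rewrite -ltnS -hcard.
  - left; exists (e :: E); split=> /=.
    + split=> //; left=> d1 d2; rewrite !hm !inE => /andP[_ h1] /andP[_ h2] h12.
      have /forall_inP/(_ _ h1)/forall_inP/(_ _ h2)/implyP := efree.
      by rewrite h12 eqxx => /(_ isT)/eqP.
    + by rewrite hs hcard.
    + by move=> x; rewrite inE hm !inE; case: eqP => // ->.
  - by right; exists S; split=> //; apply: subset_trans hS (subD1set _ _).
right; exists D; split=> // e he.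
move: nfree; rewrite negb_exists_in => /forall_inP/(_ _ he).
rewrite negb_forall_in => /exists_inP[d1 h1]; rewrite negb_forall_in => /exists_inP[d2 h2].
by rewrite negb_imply => /andP[/eqP h12 hne]; exists d1, d2.
Qed.

(** * Stuck sets among two or three pairs of opposite elements *)

Hypothesis odd_card : odd p.+2.

Lemma Zp_double_eq0 (x : A) : x + x = 0 -> x = 0.
Proof.
move=> /(congr1 val) /= h; apply: val_inj => /=.
have := ltn_ord x; have := divn_eq (x + x) p.+2; rewrite h addn0.
have : ((x + x) %/ p.+2 < 2)%N by rewrite ltn_divLR //; have := ltn_ord x; lia.
case: ((x + x) %/ p.+2)%N => [|[|]] //; first lia.
by move=> _ h2 _; exfalso; move: odd_card; lia.
Qed.

(* The stuck configurations inside [{x, -x, y, -y}]. *)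
Definition stuck_pair (x y : A) := [\/ x = 0 /\ 3 * y = 0, y = 0 /\ 3 * x = 0 |
  5 * x = 0 /\ (y = 2 * x \/ y = - (2 * x))].

Definition signed (x a : A) := a = x \/ a = - x.

(** By symmetry [e = x]. Two opposite ends force 2x = 0, the ends -x and ±y force 3x = ±y, and the
    remaining choices have equal ends. *)
Let midpoint_pair (x y e d1 d2 : A) : signed x e ->
  signed x d1 \/ signed y d1 -> signed x d2 \/ signed y d2 ->
  d1 != d2 -> d1 + d2 = e + e -> x = 0 \/ signed y (3 * x).
Proof.
have hx0 : x + x = 0 -> x = 0 by exact: Zp_double_eq0.
have h4 : 4 * x = 0 -> x = 0.
  move=> h; apply: Zp_double_eq0; apply: Zp_double_eq0; rewrite -h; ring.
wlog hw : e d1 d2 / e = x.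
  move=> hw he h1 h2 hne hsum.
  have sN a b : signed a b -> signed a (- b) by case=> ->; [right|left]; rewrite ?opprK.
  case: (he) => ee; first exact: (hw e d1 d2).
  apply: (hw (- e) (- d1) (- d2)); rewrite ?ee ?opprK //.
  - by left.
  - by case: h1 => /sN; auto.
  - by case: h2 => /sN; auto.
  - by rewrite (inj_eq oppr_inj).
  - by rewrite -opprD hsum ee opprD !opprK.
rewrite {}hw => _; case=> [] [] -> [] [] -> hne hsum; (try by rewrite eqxx in hne).
all: first
  [ by left; apply: Zp_double_eq0; rewrite -hsum; ring
  | by right; left; transitivity (x + x + x); [ring|rewrite -hsum; ring]
  | by right; right; transitivity (x + x + x); [ring|rewrite -hsum; ring]
  | by case/negP: hne; apply/eqP; apply: (addrI x); rewrite hsum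
  | by case/negP: hne; apply/eqP; apply: (addIr x); rewrite hsum ].
Qed.

Lemma stuck_nonempty S : S != set0 -> stuck S ->
  exists e d1 d2, [/\ [/\ e \in S, d1 \in S & d2 \in S], d1 + d2 = e + e &
    [/\ d1 != d2, d1 != e & d2 != e]].
Proof.
move=> /set0Pn[e he] hS; have [d1 [d2 [h1 h2 hne hsum]]] := hS _ he.
exists e, d1, d2; split=> //; split=> //; apply: contra hne => /eqP hd.
  by move: hsum; rewrite hd => /addrI ->.
by move: hsum; rewrite hd => /addIr ->.
Qed.

Let present S (z : A) : (exists2 u, u \in S & signed z u) \/
  (forall u, u \in S -> ~ signed z u).
Proof.
have [/existsP[u /andP[hu hz]]|] := boolP [exists u, (u \in S) && ((u == z) || (u == - z))].
  by left; exists u => //; case/orP: hz => /eqP; [left|right].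
rewrite negb_exists => /forallP hn; right => u hu hs; have := hn u; rewrite hu.
by case: hs => ->; rewrite eqxx ?orbT.
Qed.

Let not_single S z : S != set0 -> stuck S -> (forall d, d \in S -> signed z d) -> False.
Proof.
move=> nS hS hz.
have [e [d1 [d2 [[he h1 h2] hsum [hne ne1 ne2]]]]] := stuck_nonempty nS hS.
by case: (hz _ he) (hz _ h1) (hz _ h2) hne ne1 ne2 => -> [] -> [] ->; rewrite ?eqxx.
Qed.

Let pair_relation S x y : S != set0 -> stuck S ->
  (forall d, d \in S -> signed x d \/ signed y d) -> x = 0 \/ signed y (3 * x).
Proof.
move=> nS hS hxy; have [[u hu hxu]|nx] := present S x.
  have [c1 [c2 [hc1 hc2 hcn hcs]]] := hS _ hu.
  by apply: midpoint_pair hxu (hxy _ hc1) (hxy _ hc2) hcn hcs.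
by case: (@not_single S y) => // d hd; case: (hxy _ hd) => // /(nx _ hd).
Qed.

(** When neither element is 0, y = ±3x and x = ±3y. Equal signs give 8x = 0, hence x = 0; opposite
    signs give 10x = 0, hence 5x = 0. *)
Lemma stuck_in_pair S x y : S != set0 -> stuck S ->
  (forall d, d \in S -> signed x d \/ signed y d) -> stuck_pair x y.
Proof.
move=> nS hS hxy; have hx := pair_relation nS hS hxy.
have hy : y = 0 \/ signed x (3 * y).
  by apply: pair_relation nS hS _ => d /hxy []; auto.
have torsion2 (c : A) : 2 * c = 0 -> c = 0.
  by move=> h; apply: Zp_double_eq0; rewrite -h; ring.
case: hx => [x0|hx]; case: hy => [y0|hy].
- case: (@not_single S 0) => // d hd; case: (hxy _ hd); rewrite ?x0 ?y0 //.
- by apply: Or31; split=> //; case: hy => ->; rewrite x0 ?oppr0.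
- by apply: Or32; split=> //; case: hx => ->; rewrite y0 ?oppr0.
case: hx => hx; case: hy => hy.
- have x0 : x = 0.
    by do 3!apply/torsion2; transitivity (3 * (3 * x) - x); [ring|rewrite hx hy; ring].
  by apply: Or31; rewrite x0 -hx x0 !mulr0.
- have x0 : 5 * x = 0.
    by apply/torsion2; transitivity (3 * (3 * x) + x); [ring|rewrite hx hy; ring].
  apply: Or33; split=> //; right; rewrite -hx.
  by transitivity (5 * x - 2 * x); [ring|rewrite x0 add0r].
- have x0 : 5 * x = 0.
    apply/torsion2; transitivity (x - 3 * (- (3 * x))); first ring.
    by rewrite hx opprK hy; ring.
  apply: Or33; split=> //; left; apply: oppr_inj; rewrite -hx.
  by transitivity (5 * x - 2 * x); [ring|rewrite x0 add0r].
- have x0 : x = 0.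
    do 3!apply/torsion2; transitivity (- (3 * (- (3 * x))) - x); first ring.
    by rewrite hx opprK hy; ring.
  by apply: Or31; rewrite x0 -[y]opprK -hx x0; split=> //; ring.
Qed.

(* Here [b, c, a] are in arithmetic progression with a difference killed by 3. *)
Definition signed_progression (x y z : A) := exists a b c,
  [/\ [/\ signed x a, signed y b & signed z c], a != b, a + b = c + c & b + c = a + a].

Definition stuck_triple (N : nat) (x y z : A) :=
  [\/ [\/ stuck_pair x y, stuck_pair x z | stuck_pair y z],
      [/\ x *+ N = 0, y *+ N = 0 & z *+ N = 0] | signed_progression x y z].

(** If one of the three pairs is missed, two pairs remain. If [S] contains some [v] and [- v],
    equality of all multiples by [N] makes everything killed by [N + N]. Otherwise [S] has exactly
    one element from each pair, and each is the midpoint of the other two. *)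
Lemma stuck_in_triple S x y z N : S != set0 -> stuck S ->
  {in S &, forall d e, d *+ N = e *+ N} ->
  (forall d, d \in S -> [\/ signed x d, signed y d | signed z d]) ->
  stuck_triple (N + N) x y z.
Proof.
move=> nS hS hN hxyz.
have [[ux hux sx]|nx] := present S x; last first.
  by apply: Or31; apply: Or33; apply: stuck_in_pair nS hS _ => d hd; case: (hxyz d hd); auto => /(nx _ hd).
have [[uy huy sy]|ny] := present S y; last first.
  by apply: Or31; apply: Or32; apply: stuck_in_pair nS hS _ => d hd; case: (hxyz d hd); auto => /(ny _ hd).
have [[uz huz sz]|nz] := present S z; last first.
  by apply: Or31; apply: Or31; apply: stuck_in_pair nS hS _ => d hd; case: (hxyz d hd); auto => /(nz _ hd).
have [/exists_inP[v hv hnv]|] := boolP [exists v in S, - v \in S].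
  have tors u : u \in S -> u *+ (N + N) = 0.
    move=> hu; rewrite mulrnDr (hN _ _ hu hv) -{2}[v]opprK mulNrn -(hN _ _ hv hnv).
    exact: subrr.
  have tors' w u : u \in S -> signed w u -> w *+ (N + N) = 0.
    move=> /tors + [] e; rewrite e // mulNrn => /eqP; rewrite oppr_eq0 => /eqP //.
  by apply: Or32; split; [apply: tors' sx|apply: tors' sy|apply: tors' sz].
rewrite negb_exists_in => /forall_inP hsign.
have uniq w u d : u \in S -> signed w u -> d \in S -> signed w d -> d = u.
  move=> hu su hd sd; have h1 := hsign _ hu; have h2 := hsign _ hd.
  by move: h1 h2 hu hd; case: su sd => -> [] -> //; rewrite ?opprK => h1 h2 h3 h4;
    rewrite ?h3 ?h4 in h1 h2.
have only d : d \in S -> [\/ d = ux, d = uy | d = uz].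
  move=> hd; case: (hxyz _ hd) => sd.
  - by apply: Or31; apply: uniq sd.
  - by apply: Or32; apply: uniq sd.
  - by apply: Or33; apply: uniq sd.
have mid u v w : u \in S -> (forall d, d \in S -> [\/ d = u, d = v | d = w]) ->
    v + w = u + u /\ v != w.
  move=> hu hd; have [d1 [d2 [h1 h2 hne hsum]]] := hS _ hu.
  case: (hd _ h1) (hd _ h2) hne hsum => -> [] ->; rewrite ?eqxx // => hne hsum.
  - by move/addrI: hsum hne => ->; rewrite eqxx.
  - by move/addrI: hsum hne => ->; rewrite eqxx.
  - by move/addIr: hsum hne => ->; rewrite eqxx.
  - by move/addIr: hsum hne => ->; rewrite eqxx.
  - by rewrite addrC eq_sym.
have [e1 ne1] : ux + uy = uz + uz /\ ux != uy.
  by apply: mid => // d /only []; [apply: Or32|apply: Or33|apply: Or31].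
have [e2 _] : uy + uz = ux + ux /\ uy != uz by apply: mid.
by apply: Or33; exists ux, uy, uz.
Qed.

(** A stuck set among the six degrees is first shrunk to a cluster, which supplies the torsion
    premise of [stuck_in_triple], and then translated by [- h]. *)
Lemma symmetric_eliminable h x y z :
  (exists E : seq A, [/\ eliminable E, (size E <= 6)%N &
     forall u, [\/ signed x u, signed y u | signed z u] -> h + u \in E]) \/
  stuck_triple (cluster_exp 6 + cluster_exp 6) x y z.
Proof.
pose s := [:: h + x; h - x; h + y; h - y; h + z; h - z].
have hcard : (#|[set u in s]| <= 6)%N by rewrite cardsE (leq_trans (card_size _)).
have [[E [hE hsz hm]]|[S [hS nS sS]]] := eliminable_or_stuck [set u in s].
  left; exists E; split; rewrite ?hsz // => u hu; rewrite hm inE /s !inE.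
  by case: hu => [] [] ->; rewrite eqxx ?orbT.
right.
have hSc : (#|S| <= 6)%N by apply: leq_trans hcard; apply: subset_leq_card.
have [S' [hS' nS' sS' hN]] := stuck_cluster sS nS hSc.
pose T := [set u | h + u \in S'].
apply: (@stuck_in_triple T).
- by case/set0Pn: nS' => u hu; apply/set0Pn; exists (u - h); rewrite inE addrC subrK.
- move=> e; rewrite inE => /sS' [d1 [d2 [h1 h2 hne hsum]]].
  exists (d1 - h), (d2 - h); rewrite !inE ![h + _]addrC !subrK h1 h2.
  split=> //; first by rewrite (inj_eq (addIr _)).
  transitivity (d1 + d2 - h - h); first ring.
  by rewrite hsum; ring.
- move=> d e; rewrite !inE => hd he.
  by have := hN _ _ hd he; rewrite !mulrnDl => /addrI.
- move=> d; rewrite inE => /(subsetP hS')/(subsetP hS); rewrite !inE => hd.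
  have side w (d' := d) : (h + d' == h + w) || (h + d' == h - w) -> signed w d'.
    by case/orP=> /eqP/addrI ->; [left|right].
  move: hd; rewrite !orbA -(orbA (_ || _)) => /orP[|/side]; last exact: Or33.
  by rewrite -orbA => /orP[/side|/side]; [apply: Or31|apply: Or32].
Qed.
End Stuck.

(** * Explicit eliminable lists *)

(** Only the head matters: [k + a] is the midpoint of [k - a] and [k + g] or [k - g] exactly when 3a
    is g or -g. The other possible relations give 2a = 0. *)
Lemma four_eliminable (A : comNzRingType) (k a g : A) :
  (forall x : A, x + x = 0 -> x = 0) -> a != 0 -> 3 * a != g -> 3 * a != - g ->
  eliminable [:: k + a; k - a; k + g; k - g].
Proof.
move=> h2 na n1 n2 /=.
have na2 : 2 * a != 0 by apply: contraNneq na => h; apply/eqP/h2; rewrite -h; ring.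
do !split=> //; left=> d1 d2; rewrite ?inE //.
- by move=> /eqP -> /eqP ->.
- case/orP=> /eqP-> /orP[] /eqP-> // h.
  + by case/eqP: na2; transitivity (- ((k - a + (k - a)) - (k + g + (k - g)))); [ring|rewrite -h; ring].
  + by case/eqP: na2; transitivity (- ((k - a + (k - a)) - (k + g + (k - g)))); [ring|rewrite -h; ring].
- case/or3P=> /eqP-> /or3P[] /eqP-> // h.
  + by case/eqP: n1; transitivity (- (k + g + (k - a)) + (k + a + (k + a)) + g); [ring|rewrite -h; ring].
  + by case/eqP: n2; transitivity (- (k - g + (k - a)) + (k + a + (k + a)) - g); [ring|rewrite -h; ring].
  + by case/eqP: n1; transitivity (- (k + g + (k - a)) + (k + a + (k + a)) + g); [ring|rewrite -h; ring].
  + by case/eqP: na2; transitivity ((k + a + (k + a)) - (k + g + (k - g))); [ring|rewrite -h; ring].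
  + by case/eqP: n2; transitivity (- (k - g + (k - a)) + (k + a + (k + a)) - g); [ring|rewrite -h; ring].
  + by case/eqP: na2; transitivity ((k + a + (k + a)) - (k + g + (k - g))); [ring|rewrite -h; ring].
Qed.

Lemma two_eliminable (A : comNzRingType) (k g : A) : eliminable [:: k + g; k - g].
Proof.
by do !split=> //=; left=> d1 d2; rewrite ?inE => // /eqP -> /eqP ->.
Qed.

(** A pair [(q, c)] stands for the degree [k + q * eps + c] with [c] of bounded exponent; midpoint
    relations are tested on the integers alone, and the second component only tells elements
    apart. *)
Fixpoint int_eliminable (B : eqType) (s : seq (int * B)) : Prop :=
  if s is x :: s0 then int_eliminable s0 /\
    forall y z, y \in s0 -> z \in s0 -> y.1 + z.1 = x.1 + x.1 -> y = z
  else True.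

(** Multiplying a midpoint relation by [T] kills the torsion parts and leaves a multiple of [eps] by
    an integer of size at most [4 * b], which must therefore be 0. *)
Lemma int_eliminableP (A : comNzRingType) (k eps : A) (T b : nat) (s : seq (int * A)) :
  (forall q : int, (0 < `|q| <= 4 * b)%N -> eps *~ q *+ T != 0) ->
  (forall x, x \in s -> x.2 *+ T = 0 /\ (`|x.1| <= b)%N) ->
  int_eliminable s -> eliminable [seq k + eps *~ x.1 + x.2 | x <- s].
Proof.
move=> heps; elim: s => //= x s IH hs [h1 h2]; split.
  by apply: IH => // y hy; apply: hs; rewrite inE hy orbT.
left=> _ _ /mapP[y hy ->] /mapP[z hz ->] h.
apply/eqP; apply: contraT => hne.
have [tx bx] := hs _ (mem_head _ _).
have [ty by_] : y.2 *+ T = 0 /\ (`|y.1| <= b)%N by apply: hs; rewrite inE hy orbT.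
have [tz bz] : z.2 *+ T = 0 /\ (`|z.1| <= b)%N by apply: hs; rewrite inE hz orbT.
have hq : (0 < `|(y.1 + z.1 - (x.1 + x.1))%R| <= 4 * b)%N.
  apply/andP; split; last by lia.
  by rewrite absz_gt0 subr_eq0; apply: contraNneq hne => h12; rewrite (h2 y z).
case/eqP: (heps _ hq).
have -> : eps *~ (y.1 + z.1 - (x.1 + x.1)) = x.2 + x.2 - (y.2 + z.2).
  apply/eqP; rewrite mulrzBr !mulrzDr subr_eq; apply/eqP.
  transitivity ((k + eps *~ y.1 + y.2 + (k + eps *~ z.1 + z.2)) - k - k - y.2 - z.2); first ring.
  by rewrite h; ring.
by rewrite mulrnBl !mulrnDl tx ty tz !addr0 subr0.
Qed.

(** The integer parts are 3, -3, 1, 1, -1, -1, so [b = 3] and the bound 12 is [4 * b]. *)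
Lemma six_eliminable (A : comNzRingType) (k eps c c' : A) (T : nat) :
  (forall q : int, (0 < `|q| <= 12)%N -> eps *~ q *+ T != 0) ->
  c *+ T = 0 -> c' *+ T = 0 ->
  eliminable [:: k + (3 * eps - c); k - (3 * eps - c); k + (eps + c'); k + (eps - c');
                 k - (eps - c'); k - (eps + c')].
Proof.
move=> heps hc hc'.
pose s : seq (int * A) :=
  [:: (3, - c); (-3, c); (1, c'); (1, - c'); (-1, c'); (-1, - c')].
have -> : [:: k + (3 * eps - c); k - (3 * eps - c); k + (eps + c'); k + (eps - c');
                 k - (eps - c'); k - (eps + c')] = [seq k + eps *~ x.1 + x.2 | x <- s].
  rewrite /s /= !mulrNz !mulr1z; congr [:: _; _; _; _; _; _]; ring.
apply: (@int_eliminableP _ _ _ T 3) => //.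
- move=> x; rewrite !inE.
  by case/or4P=> [/eqP->|/eqP->|/eqP->|/or3P[]/eqP->] /=; rewrite ?mulNrn ?hc ?hc' ?oppr0.
- rewrite /s /=; repeat (match goal with |- _ /\ _ => split end); move=> // y z; rewrite ?inE //.
  + by move=> /eqP-> /eqP->.
  + by case/orP=> /eqP-> /orP[]/eqP->.
  + by case/or3P=> /eqP-> /or3P[]/eqP->.
  + by case/or4P=> /eqP-> /or4P[]/eqP->.
  + by case/or4P=> [/eqP->|/eqP->|/eqP->|/orP[]/eqP->] /or4P[/eqP->|/eqP->|/eqP->|/orP[]/eqP->].
Qed.

(** * Degrees to be avoided for given [w] and [t] *)

Section Separating.
Variable p : nat.
Local Notation A := 'I_p.+2.
Hypothesis odd_card : odd p.+2.

Let torsionM n m (u : A) : (n %| m)%N -> u *+ n = 0 -> u *+ m = 0.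
Proof. by case/dvdnP=> j -> h; rewrite mulnC mulrnA h mul0rn. Qed.

Let two_inj (x : A) : 2 * x = 0 -> x = 0.
Proof. by move=> h; apply: (Zp_double_eq0 odd_card); rewrite -h; ring. Qed.

(** In a cyclic group the elements killed by 3 are 0 and at most one opposite pair; [t = 0] serves
    when there is no such pair. *)
Lemma three_torsion : exists t : A, 3 * t = 0 /\
  forall m : A, 3 * m = 0 -> m != 0 -> t != 0 /\ signed t m.
Proof.
have val3 (m : A) : 3 * m = 0 -> m != 0 -> (3 * m = p.+2 \/ 3 * m = 2 * p.+2)%N.
  move=> h nm; have m0 : (0 < m)%N by rewrite lt0n; apply: contraNneq nm => h0; apply/eqP/val_inj.
  have : (3 * m %% p.+2 = 0)%N.
    by have := congr1 val h; rewrite mulr_natl Zp_mulrn /= mulnC.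
  have lm := ltn_ord m; have e := divn_eq (3 * m) p.+2 => h0.
  rewrite h0 addn0 in e; move: e.
  have : (3 * m %/ p.+2 < 3)%N by rewrite ltn_divLR //; lia.
  case: (3 * m %/ p.+2)%N => [|[|[|]]] //; lia.
have [[t ht nt]|no] : (exists2 t : A, 3 * t = 0 & t != 0) \/ forall m : A, 3 * m = 0 -> m = 0.
  have [/existsP[t /andP[/eqP h1 h2]]|] := boolP [exists t : A, (3 * t == 0) && (t != 0)].
    by left; exists t.
  rewrite negb_exists => /forallP h; right => m hm; have := h m.
  by rewrite hm eqxx /= negbK => /eqP.
- exists t; split=> // m hm nm; split=> //.
  have [et|et] := val3 _ ht nt; have [em|em] := val3 _ hm nm.
  + by left; apply: val_inj => /=; lia.
  + right; apply/eqP; rewrite -addr_eq0; apply/eqP; apply: val_inj => /=.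
    by have -> : (m + t = p.+2)%N; [lia|rewrite modnn].
  + right; apply/eqP; rewrite -addr_eq0; apply/eqP; apply: val_inj => /=.
    by have -> : (m + t = p.+2)%N; [lia|rewrite modnn].
  + by left; apply: val_inj => /=; lia.
- by exists 0; split=> [|m /no ->]; rewrite ?mulr0 // eqxx.
Qed.

(** The torsion elements are removed in increasing order of representatives. For torsion elements
    [d < e] the representative of [e - d] lies strictly between 0 and [e], so reflection in [e]
    preserves those already removed. *)
Lemma torsion_eliminable n : (0 < n)%N -> exists E : seq A,
  [/\ eliminable E, (size E <= n)%N & forall x : A, x *+ n = 0 -> x != 0 -> x \in E].
Proof.
move=> n0.
have [E [hE hu hm]] : exists E : seq A, [/\ eliminable E, uniq E &
    forall x : A, (x \in E) = [&& x *+ n == 0, x != 0 & (x < p.+2)%N]].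
  suff prefix b : (b <= p.+2)%N -> exists E : seq A, [/\ eliminable E, uniq E &
      forall x : A, (x \in E) = [&& x *+ n == 0, x != 0 & (x < b)%N]] by exact: prefix.
  elim: b => [|b IH] hb.
    by exists [::]; split=> // x; rewrite ltn0 !andbF.
  have [E [hE hu hm]] := IH (ltnW hb).
  pose e : A := Ordinal hb.
  have step x : x != e -> (x < b.+1)%N = (x < b)%N.
    by move=> ne; rewrite ltnS leq_eqVlt; case: eqP => // h; case/eqP: ne; apply: val_inj.
  have ltb : (e < b)%N = false by rewrite ltnn.
  have ltb1 : (e < b.+1)%N by rewrite ltnSn.
  have [/andP[h1 h2]|h] := boolP ((e *+ n == 0) && (e != 0)).
    exists (e :: E); split=> /=.
    - split=> //; right => d; rewrite !hm => /and3P[/eqP d1 d2 d3].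
      rewrite mulrnBl d1 (eqP h1) subrr eqxx /= subr_eq0.
      have -> : (e != d) by apply: contraTneq d3 => <-; rewrite ltb.
      rewrite /= modnDmr; have -> : (b + (p.+2 - d) = (b - d) + p.+2)%N by have := ltn_ord d; lia.
      have d0 : (0 < d)%N by rewrite lt0n; apply: contraNneq d2 => h0; apply/eqP/val_inj.
      by rewrite modnDr modn_small; lia.
    - by rewrite hu andbT hm ltb !andbF.
    - move=> x; rewrite inE hm; have [->|nx] := eqVneq x e; first by rewrite h1 h2 ltb1.
      by rewrite step.
  exists E; split=> // x; rewrite hm; have [->|nx] := eqVneq x e; last by rewrite step.
  by rewrite ltb !andbF; move: h; rewrite andbA; case: (_ && _).
exists E; split=> [//||x hx nx]; last by rewrite hm hx nx eqxx ltn_ord.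
have mult (x : A) : x *+ n = 0 -> (x * n = (x * n %/ p.+2) * p.+2)%N.
  move=> /(congr1 val); rewrite Zp_mulrn /= => h.
  by rewrite {1}(divn_eq (x * n) p.+2) h addn0.
(* On elements killed by [n] the quotient is exact, so [f] is injective with values below [n]; this
   bounds the size of [E]. *)
pose f (x : A) := (x * n %/ p.+2)%N.
have -> : size E = size (map f E) by rewrite size_map.
rewrite -(size_iota 0 n); apply: uniq_leq_size.
  rewrite map_inj_in_uniq // => x y; rewrite !hm => /and3P[/eqP/mult ex _ _] /and3P[/eqP/mult ey _ _].
  rewrite /f => exy; rewrite exy -ey in ex; apply: val_inj; apply/eqP.
  by rewrite -(eqn_pmul2r n0) ex.
move=> _ /mapP[x _ ->]; rewrite mem_iota add0n /= /f ltn_divLR //.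
by rewrite mulnC ltn_mul2l n0 ltn_ord.
Qed.

(* The solutions [m] of [stuck_triple] for [x = eps + m], [y = eps - m], [z = c]. *)
Inductive exceptional (N : nat) (eps m c : A) : Prop :=
| Exceptional1 of 3 * eps = 0 & signed eps m
| Exceptional2 of 5 * eps = 0 & signed (2 * eps) m
| Exceptional3 of c = 0 & 3 * (m - eps) = 0 \/ 3 * (m + eps) = 0
| Exceptional4 of 3 * c = 0 & signed eps m
| Exceptional5 of 5 * c = 0 & signed (2 * c) (m - eps) \/ signed (2 * c) (m + eps)
| Exceptional6 of 3 * eps = 0 & signed c m
| Exceptional7 of 3 * m = 0 & m != 0 & signed eps c
| ExceptionalTorsion of eps *+ N = 0 & m *+ N = 0 & c *+ N = 0.

Let eq_of_sub0 (x y : A) : x - y = 0 -> x = y.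
Proof. by move/eqP; rewrite subr_eq0 => /eqP. Qed.

Let eq_of_double (x y : A) : 2 * (x - y) = 0 -> x = y.
Proof. by move/two_inj/eq_of_sub0. Qed.

(** Linear algebra with 2 cancellable. The exponent doubles because only 2 eps and 2 m are
    combinations of [eps + m] and [eps - m]. In a progression the sign choices make its middle term
    ±eps or ±m. *)
Lemma exceptionalP N eps m c : stuck_triple N (eps + m) (eps - m) c ->
  exceptional (2 * N) eps m c.
Proof.
case=> [[] []| |].
- move=> [h1 h2].
  have em : m = - eps by apply: eq_of_sub0; rewrite -h1; ring.
  apply: Exceptional1; last by right.
  by apply: two_inj; rewrite -h2 em; ring.
- move=> [h1 h2].
  have em : m = eps by apply: eq_of_sub0; transitivity (- (eps - m)); [ring|rewrite h1 oppr0].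
  apply: Exceptional1; last by left.
  by apply: two_inj; rewrite -h2 em; ring.
- move=> [h1 [h2|h2]].
  + have e1 : eps = - (3 * m).
      by apply: eq_of_sub0; transitivity (2 * (eps + m) - (eps - m)); [ring|rewrite h2; ring].
    have m5 : 5 * m = 0.
      by apply: two_inj; transitivity (- (5 * (eps + m))); [rewrite e1; ring|rewrite h1 oppr0].
    apply: Exceptional2.
      by rewrite e1; transitivity (- (3 * (5 * m))); [ring|rewrite m5; ring].
    right; apply: eq_of_sub0; rewrite e1.
    by transitivity (- (5 * m)); [ring|rewrite m5 oppr0].
  + have e1 : m = - (3 * eps).
      apply: eq_of_sub0; transitivity (2 * (eps + m) + (eps - m)); first ring.
      by rewrite h2; ring.
    have m5 : 5 * eps = 0.
      by apply: two_inj; transitivity (- (5 * (eps + m))); [rewrite e1; ring|rewrite h1 oppr0].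
    apply: Exceptional2 => //; left; apply: eq_of_sub0; rewrite e1.
    by transitivity (- (5 * eps)); [ring|rewrite m5 oppr0].
- move=> [h1 h2]; apply: Exceptional4 => //; right.
  by apply: eq_of_sub0; rewrite -h1; ring.
- by move=> [h1 h2]; apply: Exceptional3 => //; right; rewrite -h2; ring.
- move=> [h1 h2]; apply: Exceptional5.
    by case: h2 => ->; [transitivity (2 * (5 * (eps + m)))|transitivity (- (2 * (5 * (eps + m))))];
      try ring; rewrite h1; ring.
  right; case: h2 => ->; [right|left]; apply: eq_of_sub0.
    by transitivity (5 * (eps + m)); [ring|].
  by transitivity (5 * (eps + m)); [ring|].
- move=> [h1 h2]; apply: Exceptional4 => //; left.
  by apply: eq_of_sub0; transitivity (- (eps - m)); [ring|rewrite h1 oppr0].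
- move=> [h1 h2]; apply: Exceptional3 => //; left.
  by transitivity (- (3 * (eps - m))); [ring|rewrite h2 oppr0].
- move=> [h1 h2]; apply: Exceptional5.
    by case: h2 => ->; [transitivity (2 * (5 * (eps - m)))|transitivity (- (2 * (5 * (eps - m))))];
      try ring; rewrite h1; ring.
  left; case: h2 => ->; [left|right]; apply: eq_of_sub0.
    by transitivity (- (5 * (eps - m))); [ring|rewrite h1 oppr0].
  by transitivity (- (5 * (eps - m))); [ring|rewrite h1 oppr0].
- move=> [h1 h2 h3]; apply: ExceptionalTorsion.
  + by rewrite mulrnA; have -> : eps *+ 2 = (eps + m) + (eps - m); [ring|rewrite mulrnDl h1 h2 addr0].
  + by rewrite mulrnA; have -> : m *+ 2 = (eps + m) - (eps - m); [ring|rewrite mulrnBl h1 h2 subr0].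
  + by rewrite mulrnA mulrnAC h3 mul0rn.
- move=> [a [b [d [[sa sb sd] nab e1 e2]]]].
  have had : 3 * (a - d) = 0.
    by transitivity ((a + a) - (b + d) + (a + b) - (d + d)); [ring|rewrite e1 e2; ring].
  have sdc u : signed d u -> signed c u.
    by case: sd => -> [] ->; rewrite ?opprK; [left|right|right|left].
  have sdc' u : signed u d -> signed u c.
    by case: sd => -> [] h; [left|right|right|left] => //; rewrite -?h ?opprK //; apply: oppr_inj; rewrite h ?opprK.
  case: sa sb => ea [] eb; rewrite {}ea {}eb in nab e1 e2 had.
  + have ed : d = eps by apply: eq_of_double; transitivity (d + d - (eps + eps)); [ring|rewrite -e1; ring].
    apply: Exceptional7.
    * by rewrite -had ed; ring.
    * by apply: contraNneq nab => ->; rewrite addr0 subr0.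
    * by apply: sdc'; left.
  + have ed : d = m by apply: eq_of_double; transitivity (d + d - (m + m)); [ring|rewrite -e1; ring].
    apply: Exceptional6; first by rewrite -had ed; ring.
    by apply: sdc; left.
  + have ed : m = - d by apply: eq_of_double; transitivity (d + d + (m + m)); [ring|rewrite -e1; ring].
    apply: Exceptional6; last by apply: sdc; right.
    by transitivity (- (3 * (- (eps + m) - d))); [rewrite ed; ring|rewrite had oppr0].
  + have ed : d = - eps by apply: eq_of_double; transitivity (d + d + (eps + eps)); [ring|rewrite -e1; ring].
    apply: Exceptional7.
    * by transitivity (- (3 * (- (eps + m) - d))); [rewrite ed; ring|rewrite had oppr0].
    * by apply: contraNneq nab => ->; rewrite addr0 subr0.
    * by apply: sdc'; right.
Qed.

Let torsion_nat j n (u : A) : (j %| n)%N -> j%:R * u = 0 -> u *+ n = 0.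
Proof. by move=> h e; apply: torsionM h _; rewrite -mulr_natl. Qed.

Let torsion_signed n (u v : A) : signed u v -> u *+ n = 0 -> v *+ n = 0.
Proof. by case=> -> h; rewrite ?mulNrn h ?oppr0. Qed.

Lemma halve (t : A) : exists k : A, t = k + k.
Proof.
exists (t *+ (p.+3)./2); rewrite -mulrnDr addnn.
have -> : ((p.+3)./2.*2 = p.+2 + 1)%N by move: odd_card; lia.
rewrite mulrnDr mulr1n Zp_mulrn.
have -> : inZp (t * p.+2) = 0 :> A by apply: val_inj; rewrite /= modnMl.
by rewrite add0r.
Qed.

(* [i = 0] and [i = 2k] need not be avoided because the component of degree [0] vanishes;
   without them every cluster of exceptional degrees has at most two elements. *)
Lemma exceptional_eliminable (N M1 M2 : nat) (eps c k : A) :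
  (60 %| M1)%N -> (N %| M1)%N -> (forall q, (0 < q <= 12)%N -> (q * M1 %| M2)%N) ->
  (0 < M2)%N -> eps != 0 -> k = c - eps ->
  exists E : seq A, [/\ eliminable E, (size E <= maxn 6 M2)%N &
    forall i, i != 0 -> i != k + k ->
      exceptional N eps (i - k) c \/ signed (3 * eps - c) (i - k) -> i \in E].
Proof.
move=> d60 dN dM M2gt0 neps ek.
have d12 : (M1 %| M2)%N by have := dM 1 isT; rewrite mul1n.
have dj j : (j %| 60)%N -> (j %| M1)%N by move=> h; apply: dvdn_trans d60.
have ik i : i = k + (i - k) by rewrite addrC subrK.
(* When [eps] and [c] are both killed by [M2], so are all degrees to avoid, and the whole torsion
   subgroup is eliminated. *)
have [/andP[/eqP teps /eqP tc]|nt] := boolP ((eps *+ M2 == 0) && (c *+ M2 == 0)).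
  have [E [hE hs hm]] := torsion_eliminable M2gt0.
  exists E; split; rewrite ?(leq_trans hs) ?leq_maxr // => i i0 _ hi.
  apply: hm => //; rewrite (ik i) mulrnDl {1}ek mulrnBl tc teps subr0 add0r.
  move: hi; set m := i - k => hi.
  have tj j (u : A) : (j %| 60)%N -> j%:R * u = 0 -> u *+ M2 = 0.
    by move=> /dj hj; apply: torsion_nat; apply: dvdn_trans hj d12.
  have tX j (u : A) : u *+ M2 = 0 -> (j%:R * u) *+ M2 = 0.
    by move=> h; rewrite -mulrnAr h mulr0.
  case: hi => [[]|].
  - by move=> _ /torsion_signed; apply.
  - by move=> _ /torsion_signed; apply; apply: tX.
  - move=> _ [] /(tj 3) h.
      by rewrite -[m](subrK eps) mulrnDl h // teps addr0.
    by rewrite -[m](addrK eps) mulrnBl h // teps subr0.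
  - by move=> _ /torsion_signed; apply.
  - move=> _ [] /torsion_signed /(_ (tX 2 _ tc)) h.
      by rewrite -[m](subrK eps) mulrnDl h teps addr0.
    by rewrite -[m](addrK eps) mulrnBl h teps subr0.
  - by move=> _ /torsion_signed; apply.
  - by move=> /(tj 3) ->.
  - by move=> _ h _; apply: torsionM h; apply: dvdn_trans dN d12.
  - by move=> /torsion_signed; apply; rewrite mulrnBl tX // tc subrr.
(* If [c] is killed by [M1], then no [q * eps] with 0 < q <= 12 is, since [q * M1] divides [M2];
   this is the premise of [six_eliminable]. *)
have [tc|ntc] := eqVneq (c *+ M1) 0.
  have heps (q : nat) : (0 < q <= 12)%N -> eps *+ q *+ M1 != 0.
    move=> hq; apply: contraNneq nt => h.
    rewrite (torsionM d12 tc) eqxx andbT -mulrnA in h *.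
    by apply/eqP; apply: torsionM h; apply: dM.
  have hepsz (q : int) : (0 < `|q| <= 12)%N -> eps *~ q *+ M1 != 0.
    case: q => q hq; first exact: heps.
    by rewrite NegzE mulrNz mulNrn oppr_eq0; apply: heps.
  have neps_j (j : nat) : (j %| 60)%N -> j%:R * eps != 0.
    move=> /dj hj; apply: contraTneq (heps 1%N isT) => h.
    by rewrite negbK mulr1n; apply/eqP; apply: torsion_nat hj h.
  have [tau [tau3 tauP]] := three_torsion.
  (* Only the cases with c = 0, 3c = 0 or 5c = 0 survive, and they put [m] in ±eps ± c' for this
     [c']. For c = 0 the values m = ±eps are excluded, being i = 0 and i = 2k. *)
  pose c' := if c == 0 then tau else if 5%:R * c == 0 then 2 * c else 0.
  have tc' : c' *+ M1 = 0.
    rewrite /c'; case: ifP => _; first by apply: torsion_nat tau3; apply: dj.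
    case: ifP => _; last exact: mul0rn.
    by rewrite -mulrnAr tc mulr0.
  exists [:: k + (3 * eps - c); k - (3 * eps - c); k + (eps + c'); k + (eps - c');
                 k - (eps - c'); k - (eps + c')].
  split; [exact: six_eliminable hepsz tc tc'|by rewrite leq_max|].
  move=> i ni0 nikk hi; rewrite (ik i) !inE !(inj_eq (addrI k)).
  have : i - k != - k by rewrite -subr_eq0 opprK subrK.
  have : i - k != k by apply: contraNneq nikk => h; rewrite (ik i) h.
  move: hi; set m := i - k => hi m1 m2.
  suff : signed (3 * eps - c) m \/ signed (eps + c') m \/ signed (eps - c') m.
    by case=> [[]|[[]|[]]] ->; rewrite eqxx ?orbT.
  have neps_t : eps *+ M1 != 0 by have := heps 1%N isT.
  case: hi => [[]|]; last by left.
  - by move=> /eqP; rewrite (negPf (neps_j 3 _)).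
  - by move=> /eqP; rewrite (negPf (neps_j 5 _)).
  - move=> c0; have ec' : c' = tau by rewrite /c' c0 eqxx.
    have ke : k = - eps by rewrite ek c0 sub0r.
    rewrite ke opprK in m1 m2; rewrite ec' => -[] h3.
      have nm : m - eps != 0 by rewrite subr_eq0.
      by have [_ [] h] := tauP _ h3 nm; right; [left|right]; left; rewrite -h addrC subrK.
    have nm : m + eps != 0 by rewrite addr_eq0.
    have [_ [] h] := tauP _ h3 nm; right; [right|left]; right.
      by rewrite -h; ring.
    by rewrite -[LHS](addrK eps) h; ring.
  - move=> h3 hm; have [c0|nc] := eqVneq c 0.
      by move: m1 m2; rewrite ek c0 sub0r opprK; case: hm => ->; rewrite eqxx.
    have e5 : (5%:R * c == 0) = false.
      apply: contraNF nc => /eqP h5; apply/eqP.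
      by transitivity (2 * (3 * c) - 5 * c); [ring|rewrite h3 h5; ring].
    by right; left; rewrite /c' (negPf nc) e5 addr0.
  - move=> h5 hm; have [c0|nc] := eqVneq c 0.
      move: m1 m2; rewrite ek c0 sub0r opprK => m1 m2.
      by case: hm; rewrite c0 mulr0 => -[] /eqP; rewrite ?oppr0 ?subr_eq0 ?addr_eq0 ?(negPf m1) ?(negPf m2).
    rewrite /c' (negPf nc) h5 eqxx; right; case: hm => -[] h.
    + by left; left; rewrite -h addrC subrK.
    + by right; left; rewrite -h addrC subrK.
    + by right; right; rewrite -h; ring.
    + by left; right; rewrite -[LHS](addrK eps) h; ring.
  - by move=> /eqP; rewrite (negPf (neps_j 3 _)).
  - move=> _ _ h; case/eqP: neps_t.
    by case: h tc => -> //; rewrite mulNrn => /eqP; rewrite oppr_eq0 => /eqP.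
  - by move=> h; case/eqP: neps_t; apply: torsionM h.
have nc j : (j %| 60)%N -> j%:R * c != 0.
  by move=> /dj hj; apply: contraNneq ntc => h; apply/eqP; apply: torsion_nat hj h.
(* It suffices to find one [a] such that each exceptional [m] is ±(3 eps - c) or ±a. When [a]
   violates a condition of [four_eliminable], the second alternative never occurs and two degrees
   suffice. *)
have finish a : (forall i, exceptional N eps (i - k) c ->
      signed (3 * eps - c) (i - k) \/ [/\ a != 0, 3 * a != 3 * eps - c,
        3 * a != - (3 * eps - c) & signed a (i - k)]) ->
    exists E : seq A, [/\ eliminable E, (size E <= maxn 6 M2)%N &
    forall i, i != 0 -> i != k + k ->
      exceptional N eps (i - k) c \/ signed (3 * eps - c) (i - k) -> i \in E].
  move=> ha; have [/and3P[n1 n2 n3]|ncond] := boolP [&& a != 0, 3 * a != 3 * eps - c &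
      3 * a != - (3 * eps - c)].
    exists [:: k + a; k - a; k + (3 * eps - c); k - (3 * eps - c)]; split.
    - by apply: four_eliminable => //; apply: Zp_double_eq0.
    - by rewrite leq_max.
    - move=> i _ _ hi; have : signed (3 * eps - c) (i - k) \/ signed a (i - k).
        by case: hi => [/ha [|[]]|]; auto.
      rewrite (ik i) !inE !(inj_eq (addrI k)) -(ik i).
      by case=> [] [] ->; rewrite eqxx ?orbT.
  exists [:: k + (3 * eps - c); k - (3 * eps - c)]; split.
  - exact: two_eliminable.
  - by rewrite leq_max.
  - move=> i _ _ hi; have : signed (3 * eps - c) (i - k).
      by case: hi => // /ha [//|[h1 h2 h3]]; case/negP: ncond; apply/and3P.
    rewrite (ik i) !inE !(inj_eq (addrI k)) -(ik i).
    by case=> ->; rewrite eqxx ?orbT.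
have nsigned j (u : A) : (j %| 60)%N -> j%:R * u = 0 -> ~ signed u c.
  move=> hj hu hc; case/eqP: (nc _ hj).
  by case: hc => ->; rewrite ?mulrN hu ?oppr0.
have exc_c i : exceptional N eps i c -> [\/ 3 * eps = 0 /\ (signed eps i \/ signed c i),
    5 * eps = 0 /\ signed (2 * eps) i | [/\ 3 * i = 0, i != 0 & signed eps c]].
  case=> [h1 h2|h1 h2|h1 h2|h1 h2|h1 h2|h1 h2|h1 h2 h3|h1 h2 h3].
  - by apply: Or31; auto.
  - exact: Or32.
  - by case/eqP: (nc 1%N isT); rewrite h1 mulr0.
  - by case/eqP: (nc 3%N isT).
  - by case/eqP: (nc 5%N isT).
  - by apply: Or31; auto.
  - exact: Or33.
  - by case/eqP: ntc; apply: torsionM h3.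
(* The three kinds of exceptional [m] exclude each other: [a] is [eps] if 3 eps = 0, [2 * eps] if 5
   eps = 0, and an element of order 3 otherwise. In the first case m = ±c is already ±(3 eps -
   c). *)
have [e3|n3] := eqVneq (3 * eps) 0.
  apply: (finish eps) => i /exc_c [[_ [h|h]]|[h5 _]|[_ _ /nsigned h]].
  - right; split=> //; rewrite e3 sub0r.
      by rewrite eq_sym oppr_eq0; have := nc 1%N isT; rewrite mul1r.
    by rewrite opprK eq_sym; have := nc 1%N isT; rewrite mul1r.
  - by left; rewrite e3 sub0r; case: h => ->; [right; rewrite opprK|left].
  - case/eqP: neps; transitivity (2 * (3 * eps) - 5 * eps); first ring.
    by rewrite e3 h5; ring.
  - by case: (h 3%N).
have [e5|n5] := eqVneq (5 * eps) 0.
  apply: (finish (2 * eps)) => i /exc_c [[/eqP]|[_ h]|[_ _ /nsigned h]].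
  - by rewrite (negPf n3).
  - have ne2 : 2 * eps != 0 by apply: contraNneq neps => /two_inj ->.
    right; split=> //; apply: contraNneq (nc 5%N isT) => hc; apply/eqP.
      transitivity (3 * (5 * eps) - 5 * (3 * eps - c)); first ring.
      by rewrite -hc; transitivity (- (3 * (5 * eps))); [ring|rewrite e5 mulr0 oppr0].
    transitivity (3 * (5 * eps) + 5 * (- (3 * eps - c))); first ring.
    by rewrite -hc; transitivity (9 * (5 * eps)); [ring|rewrite e5 mulr0].
  - by case: (h 5%N).
have [tau [tau3 tauP]] := three_torsion.
apply: (finish tau) => i /exc_c [[/eqP]|[/eqP]|[h1 h2 hc]].
- by rewrite (negPf n3).
- by rewrite (negPf n5).
have main (u : A) : u = 0 -> signed eps c -> u = 3 * eps - c -> eps = 0.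
  move=> -> [] -> /esym h; apply/two_inj; first by rewrite -h; ring.
  by apply/two_inj; rewrite -h; ring.
have [nt0 st] := tauP _ h1 h2; right; rewrite tau3 nt0; split=> //.
- by apply: contraNneq neps => /main ->.
- apply: contraNneq neps => h; apply/eqP/(main 0) => //; apply: oppr_inj.
  by rewrite oppr0.
Qed.
End Separating.

(** For the degrees l, w - l, i, t - i, the six listed values of [l] are those at which a partial
    sum depending on [l], with at least two terms, vanishes; [i != - w] and [i != t + w] handle w +
    i and w + t - i. *)
Definition separating (A : comNzRingType) (s : nat) := forall w t : A, w + t != 0 ->
  exists E2 : seq A, [/\ eliminable E2, (size E2 <= s)%N &
  forall i, i \notin E2 -> i != 0 -> i != t -> [/\ i != - w, i != t + w &
  exists E : seq A, [/\ eliminable E, (size E <= s)%N &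
    {subset [:: - i; i - t; w + i; w + (t - i); - t; t + w] <= E}]]].

(* With [w = 2h], [t = 2k] and [i = k + m], the six degrees are symmetric about [h]. *)
Lemma odd_separating : exists s, forall p, odd p.+2 -> separating 'I_p.+2 s.
Proof.
(* The factor 60 absorbs torsion of orders 3 and 5, and [12!] the multipliers [q]. *)
have [M1 [M2 [d60 dN dM M2gt0]]] : exists M1 M2 : nat, [/\ (60 %| M1)%N,
    (2 * (cluster_exp 6 + cluster_exp 6) %| M1)%N,
    forall q, (0 < q <= 12)%N -> (q * M1 %| M2)%N & (0 < M2)%N].
  have : (0 < cluster_exp 6)%N by rewrite /cluster_exp -lock fact_gt0.
  move: (cluster_exp 6) => N N0; set M := (60 * (2 * (N + N)))%N.
  exists M, (12`! * M)%N; split.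
  - exact: dvdn_mulr.
  - exact: dvdn_mull.
  - by move=> q hq; rewrite dvdn_mul // dvdn_fact.
  - by rewrite muln_gt0 fact_gt0 /M !muln_gt0 addn_gt0 N0.
exists (maxn 6 M2) => p odd_card w t nwt.
have [h ew] := halve odd_card w; have [k et] := halve odd_card t.
have neps : k + h != 0.
  by apply: contraNneq nwt => e; rewrite ew et; apply/eqP; transitivity (2 * (k + h)); [ring|rewrite e mulr0].
have ek : k = (k + k + h) - (k + h) by ring.
have [E2 [hE2 hs2 hin]] := exceptional_eliminable odd_card d60 dN dM M2gt0 neps ek.
exists E2; split=> // i niE ni0 nit.
have nexc : ~ (exceptional (2 * (cluster_exp 6 + cluster_exp 6)) (k + h) (i - k) (k + k + h) \/
    signed (3 * (k + h) - (k + k + h)) (i - k)).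
  by move=> hi; case/negP: niE; apply: (hin _ ni0 _ hi); rewrite -et.
split.
(* With eps = k + h and c = 2k + h, the additional values i - k = ±(3 eps - c) are exactly i = t + w
   and i = -w. *)
- apply/eqP => e; apply: nexc; right; right; rewrite e ew; ring.
- apply/eqP => e; apply: nexc; right; left; rewrite e ew et; ring.
- have [[E [hE hs hm]]|hst] :=
    symmetric_eliminable odd_card h (k + h + (i - k)) (k + h - (i - k)) (k + k + h); last first.
    by case: nexc; left; apply: exceptionalP.
  exists E; split=> //; first by rewrite leq_max hs.
  have sub u : [\/ signed (k + h + (i - k)) (u - h), signed (k + h - (i - k)) (u - h) |
      signed (k + k + h) (u - h)] -> u \in E.
    by move/hm; rewrite addrC subrK.
  move=> u; rewrite !inE => /or4P[/eqP->|/eqP->|/eqP->|/or3P[]/eqP->]; apply: sub; rewrite ?ew ?et.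
  - by apply: Or31; right; ring.
  - by apply: Or32; right; ring.
  - by apply: Or31; left; ring.
  - by apply: Or32; left; ring.
  - by apply: Or33; right; ring.
  - by apply: Or33; left; ring.
Qed.

(** * From the selective relation to an abelian derived term *)

Section Selective.
Variables (K : fieldType) (L : lmodType K) (br : L -> L -> L).
Hypothesis lie : is_lie_bracket br.
Variable A : comNzRingType.
Hypothesis no_2torsion : forall x : A, x + x = 0 -> x = 0.
Implicit Type M : A -> L -> Prop.

(** Nonvanishing of single degrees is not demanded: in a graded family the component of degree 0 is
    trivial anyway. *)
Definition selective M := forall a b c d x y z v,
  M a x -> M b y -> M c z -> M d v ->
  [/\ a + b + c + d != 0, a + b + c != 0, a + b + d != 0, a + c + d != 0 & b + c + d != 0] ->
  [/\ a + b != 0, a + c != 0, a + d != 0, b + c != 0 & b + d != 0] -> c + d != 0 ->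
  br (br x y) (br z v) = 0.

Lemma selective_der M s : graded br M -> selective M -> separating A s ->
  forall a x, iter (2 ^ s).+1 (der br (A := A)) M a x -> x = 0.
Proof.
move=> hM hsel hsep a x; rewrite iterS.
have h0 b y : b = 0 -> M b y -> y = 0 by move=> -> hy; apply: (graded_0 hM).
apply: (span_sub (T := fun x => x = 0)).
  by split=> [|c y z -> ->]; rewrite ?scaler0 ?addr0.
move=> _ [w [u [v [hu [hv ->]]]]]; set t := a - w in hv.
have sub b y : iter (2 ^ s) (der br (A := A)) M b y -> M b y by apply: iter_der_le (leq0n _) _ _.
have [wt|nwt] := eqVneq (w + t) 0.
  by apply: (h0 (w + t)) => //; apply: (graded_br hM); apply: sub.
have [E2 [hE2 hs2 hin]] := hsep _ _ nwt.
have lin2 c y z : br u (c *: y + z) = c *: br u y + br u z by rewrite (brDr lie) (brZr lie).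
(* [v] is replaced by products [br pp q] with the degree of [pp] outside [E2]; afterwards [u] is
   treated likewise with the list [E] belonging to [i]. *)
apply: (avoid_degrees lie no_2torsion hM hE2 hs2 lin2 _ hv) => i pp q hi hp hq.
have [i0|ni0] := eqVneq i 0; first by rewrite (h0 _ _ i0 hp) (br0l lie) (br0r lie).
have [it|nit] := eqVneq i t.
  have -> : q = 0 by apply: h0 hq; rewrite it subrr.
  by rewrite !(br0r lie).
have [n1 n2 [E [hE hs hm]]] := hin _ hi ni0 nit.
have lin1 c y z : br (c *: y + z) (br pp q) = c *: br y (br pp q) + br z (br pp q).
  by rewrite (brDl lie) (brZl lie).
apply: (avoid_degrees lie no_2torsion hM hE hs lin1 _ hu) => l r r' hl hr hr'.
have [w0|nw] := eqVneq w 0.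
  have -> : br r r' = 0; last by rewrite (br0l lie).
  by apply: (h0 (l + (w - l))); [rewrite addrC subrK|apply: (graded_br hM)].
have [t0|nt] := eqVneq t 0.
  have -> : br pp q = 0; last by rewrite (br0r lie).
  by apply: (h0 (i + (t - i))); [rewrite addrC subrK|apply: (graded_br hM)].
have [l0|nl] := eqVneq l 0; first by rewrite (h0 _ _ l0 hr) !(br0l lie).
have nE e : e \in [:: - i; i - t; w + i; w + (t - i); - t; t + w] -> l != e.
  by move=> he; apply: contraNneq hl => ->; apply: hm.
have nE' e f : e \in [:: - i; i - t; w + i; w + (t - i); - t; t + w] ->
    (f = l - e \/ f = - (l - e)) -> f != 0.
  by move=> /nE hle [] ->; rewrite ?oppr_eq0 subr_eq0.
apply: (hsel _ _ _ _ _ _ _ _ hr hr' hp hq); first split.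
- by have -> : l + (w - l) + i + (t - i) = w + t by ring.
- by have -> : l + (w - l) + i = i - (- w); [ring|rewrite subr_eq0].
- by have -> : l + (w - l) + (t - i) = - (i - (t + w)); [ring|rewrite oppr_eq0 subr_eq0].
- by apply: (nE' (- t)); [rewrite !inE eqxx ?orbT|left; ring].
- by apply: (nE' (t + w)); [rewrite !inE eqxx ?orbT|right; ring].
- split.
  + by have -> : l + (w - l) = w by ring.
  + by apply: (nE' (- i)); [rewrite !inE eqxx ?orbT|left; ring].
  + by apply: (nE' (i - t)); [rewrite !inE eqxx ?orbT|left; ring].
  + by apply: (nE' (w + i)); [rewrite !inE eqxx ?orbT|right; ring].
  + by apply: (nE' (w + (t - i))); [rewrite !inE eqxx ?orbT|right; ring].
- by have -> : i + (t - i) = t by ring.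
Qed.
End Selective.

(** * Scalar extension and eigenspaces *)

Section ScalarExtension.
Variables (K : fieldType) (L : lmodType K) (br : L -> L -> L).
Hypothesis lie : is_lie_bracket br.
Variables (h : {poly K}) (m : nat).
Hypothesis size_h : size h = m.+2.

(* [K[X]/(h) (x) L], written in the basis [1, X, ..., X^m]; [tens q l] is [q (x) l] *)
Definition ext := {ffun 'I_m.+1 -> L}.

Definition tens (q : {poly K}) (l : L) : ext := [ffun k : 'I_m.+1 => (q %% h)`_k *: l].
Definition pmul (q : {poly K}) (f : ext) : ext := \sum_(k < m.+1) tens (q * 'X^k) (f k).
Definition ext_br (f g : ext) : ext :=
  \sum_(i < m.+1) \sum_(j < m.+1) tens ('X^i * 'X^j) (br (f i) (g j)).

Let h0 : h != 0. Proof. by rewrite -size_poly_eq0 size_h. Qed.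

Lemma tensDl q r l : tens (q + r) l = tens q l + tens r l.
Proof. by apply/ffunP => k; rewrite !ffunE modpD coefD scalerDl. Qed.
Lemma tensDr q l l' : tens q (l + l') = tens q l + tens q l'.
Proof. by apply/ffunP => k; rewrite !ffunE scalerDr. Qed.
Lemma tensZl c q l : tens (c *: q) l = c *: tens q l.
Proof. by apply/ffunP => k; rewrite !ffunE modpZl coefZ scalerA. Qed.
Lemma tensZr c q l : tens q (c *: l) = c *: tens q l.
Proof. by apply/ffunP => k; rewrite !ffunE !scalerA mulrC. Qed.
Lemma tens0l l : tens 0 l = 0.
Proof. by rewrite -(scale0r 0) tensZl scale0r. Qed.
Lemma tens0r q : tens q 0 = 0.
Proof. by rewrite -(scale0r 0) tensZr scale0r. Qed.
Lemma tens_suml I (r : seq I) (P : pred I) (F : I -> {poly K}) l :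
  tens (\sum_(i <- r | P i) F i) l = \sum_(i <- r | P i) tens (F i) l.
Proof. by apply: (big_morph (tens^~ l)) => [x y|]; rewrite ?tensDl ?tens0l. Qed.

Lemma tens_mod q r l : q %% h = r %% h -> tens q l = tens r l.
Proof. by move=> e; apply/ffunP => k; rewrite !ffunE e. Qed.

Lemma tens_decomp (f : ext) : f = \sum_(k < m.+1) tens 'X^k (f k).
Proof.
have hX (k : 'I_m.+1) : 'X^k %% h = 'X^k.
  by rewrite modp_small // size_polyXn size_h ltnS.
apply/ffunP => i; rewrite sum_ffunE (bigD1 i) //= big1 => [|k nk]; rewrite ffunE hX coefXn.
  by rewrite eqxx scale1r addr0.
by rewrite (_ : (i == k :> nat) = false) ?scale0r //; apply: negbTE; rewrite eq_sym.
Qed.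

(** Reduction modulo [h] before or after multiplication by [r] gives the same tensor. *)
Lemma sum_tens_coef q r l :
  \sum_(i < m.+1) (q %% h)`_i *: tens (r * 'X^i) l = tens (r * q) l.
Proof.
under eq_bigr do rewrite -tensZl scalerAr.
rewrite -tens_suml -mulr_sumr; apply: tens_mod.
have -> : \sum_(i < m.+1) (q %% h)`_i *: 'X^i = q %% h.
  rewrite -[RHS](coefK) poly_def.
  have hs : (size (q %% h)%R <= m.+1)%N by rewrite -ltnS -size_h ltn_modp.
  rewrite (big_ord_widen _ (fun i => (q %% h)`_i *: 'X^i) hs) [RHS]big_mkcond.
  apply: eq_bigr => i _; case: ltnP => // hi.
  by rewrite nth_default // scale0r.
by rewrite modp_mul.
Qed.

Lemma pmul_tens q r l : pmul q (tens r l) = tens (q * r) l.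
Proof.
rewrite /pmul; under eq_bigr do rewrite ffunE tensZr.
exact: sum_tens_coef.
Qed.

Lemma ext_br_tens q r l l' : ext_br (tens q l) (tens r l') = tens (q * r) (br l l').
Proof.
rewrite /ext_br; under eq_bigr do under eq_bigr do
  rewrite !ffunE (brZl lie) (brZr lie) !tensZr.
under eq_bigr do rewrite -scaler_sumr sum_tens_coef mulrC.
by rewrite sum_tens_coef mulrC.
Qed.

Lemma ext_ind (P : ext -> Prop) : P 0 -> (forall f g, P f -> P g -> P (f + g)) ->
  (forall q l, P (tens q l)) -> forall f, P f.
Proof. by move=> P0 PD Pt f; rewrite (tens_decomp f); apply: big_ind. Qed.

Lemma pmulDr q f g : pmul q (f + g) = pmul q f + pmul q g.
Proof. by rewrite /pmul -big_split; apply: eq_bigr => k _; rewrite ffunE tensDr. Qed.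
Lemma pmulZr q c f : pmul q (c *: f) = c *: pmul q f.
Proof. by rewrite /pmul scaler_sumr; apply: eq_bigr => k _; rewrite ffunE tensZr. Qed.
Lemma pmulDl q r f : pmul (q + r) f = pmul q f + pmul r f.
Proof. by rewrite /pmul -big_split; apply: eq_bigr => k _; rewrite mulrDl tensDl. Qed.
Lemma pmul0r q : pmul q 0 = 0.
Proof. by rewrite -(scale0r 0) pmulZr !scale0r. Qed.
Lemma pmul0l f : pmul 0 f = 0.
Proof. by rewrite /pmul big1 // => k _; rewrite mul0r tens0l. Qed.
Lemma pmul_suml I (r : seq I) (P : pred I) (F : I -> {poly K}) f :
  pmul (\sum_(i <- r | P i) F i) f = \sum_(i <- r | P i) pmul (F i) f.
Proof. by apply: (big_morph (pmul^~ f)) => [x y|]; rewrite ?pmulDl ?pmul0l. Qed.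
Lemma pmul_sumr I (r : seq I) (P : pred I) (F : I -> ext) q :
  pmul q (\sum_(i <- r | P i) F i) = \sum_(i <- r | P i) pmul q (F i).
Proof. by apply: (big_morph (pmul q)) => [x y|]; rewrite ?pmulDr ?pmul0r. Qed.

Lemma pmulA q r f : pmul q (pmul r f) = pmul (q * r) f.
Proof.
move: f; apply: ext_ind => [|f g hf hg|q' l]; first by rewrite !pmul0r.
  by rewrite !pmulDr hf hg.
by rewrite !pmul_tens mulrA.
Qed.
Lemma pmul1 f : pmul 1 f = f.
Proof.
move: f; apply: ext_ind => [|f g hf hg|q' l]; first by rewrite !pmul0r.
  by rewrite !pmulDr hf hg.
by rewrite pmul_tens mul1r.
Qed.
Lemma pmul_mod q r f : q %% h = r %% h -> pmul q f = pmul r f.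
Proof.
move=> e; apply: eq_bigr => k _; apply: tens_mod.
by rewrite -!(mulrC 'X^k) -[LHS]modp_mul e modp_mul.
Qed.
Lemma pmul_dvd q f : h %| q -> pmul q f = 0.
Proof. by move=> /modp_eq0 e; rewrite (@pmul_mod q 0) ?pmul0l // e mod0p. Qed.

Lemma ext_brDl f g k : ext_br (f + g) k = ext_br f k + ext_br g k.
Proof.
rewrite /ext_br -big_split; apply: eq_bigr => i _; rewrite -big_split.
by apply: eq_bigr => j _; rewrite ffunE (brDl lie) tensDr.
Qed.
Lemma ext_brDr f g k : ext_br f (g + k) = ext_br f g + ext_br f k.
Proof.
rewrite /ext_br -big_split; apply: eq_bigr => i _; rewrite -big_split.
by apply: eq_bigr => j _; rewrite ffunE (brDr lie) tensDr.
Qed.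
Lemma ext_brZl c f g : ext_br (c *: f) g = c *: ext_br f g.
Proof.
rewrite /ext_br scaler_sumr; apply: eq_bigr => i _; rewrite scaler_sumr.
by apply: eq_bigr => j _; rewrite ffunE (brZl lie) tensZr.
Qed.
Lemma ext_brZr c f g : ext_br f (c *: g) = c *: ext_br f g.
Proof.
rewrite /ext_br scaler_sumr; apply: eq_bigr => i _; rewrite scaler_sumr.
by apply: eq_bigr => j _; rewrite ffunE (brZr lie) tensZr.
Qed.
Lemma ext_br0l f : ext_br 0 f = 0.
Proof. by rewrite -(scale0r 0) ext_brZl !scale0r. Qed.
Lemma ext_br0r f : ext_br f 0 = 0.
Proof. by rewrite -(scale0r 0) ext_brZr !scale0r. Qed.

Lemma ext_brC f g : ext_br f g = - ext_br g f.
Proof.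
move: f; apply: ext_ind => [|f k hf hk|q l]; first by rewrite ext_br0l ext_br0r oppr0.
  by rewrite ext_brDl ext_brDr hf hk opprD.
move: g; apply: ext_ind => [|f k hf hk|q' l']; first by rewrite ext_br0l ext_br0r oppr0.
  by rewrite ext_brDl ext_brDr hf hk opprD.
by rewrite !ext_br_tens (brC lie) mulrC -scaleN1r tensZr scaleN1r.
Qed.

Lemma ext_is_lie : is_lie_bracket ext_br.
Proof.
split.
- by move=> c f g k; rewrite ext_brDl ext_brZl.
- by move=> c f g k; rewrite ext_brDr ext_brZr.
- apply: ext_ind => [|f g hf hg|q l]; first exact: ext_br0l.
    by rewrite ext_brDl !ext_brDr hf hg (ext_brC g) add0r addr0 subrr.
  by rewrite ext_br_tens; case: lie => _ _ -> _; rewrite tens0r.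
(* The Jacobi sum is cyclically symmetric, so one reduction to pure tensors serves each of the three
   arguments in turn. *)
- have add3 g k : (forall q l, ext_br (tens q l) (ext_br g k) + ext_br g (ext_br k (tens q l))
      + ext_br k (ext_br (tens q l) g) = 0) ->
      forall f, ext_br f (ext_br g k) + ext_br g (ext_br k f) + ext_br k (ext_br f g) = 0.
    move=> ht; apply: ext_ind => // [|f f' hf hf'].
      by rewrite !ext_br0l !ext_br0r !addr0.
    by rewrite !(ext_brDl, ext_brDr) [X in X + _]addrACA [LHS]addrACA hf hf' addr0.
  move=> f g k; apply: (add3) => q l; rewrite -addrA addrC.
  apply: (add3) => q' l'; rewrite -addrA addrC; apply: (add3) => q'' l''.
  rewrite !ext_br_tens; set Q := q'' * _.
  have -> : q * (q' * q'') = Q by rewrite /Q; ring.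
  have -> : q' * (q'' * q) = Q by rewrite /Q; ring.
  rewrite -!tensDr; case: lie => _ _ _ jac.
  by rewrite jac tens0r.
Qed.

Section Functoriality.
Variable phi : L -> L.
Hypothesis phi_lin : forall c x y, phi (c *: x + y) = c *: phi x + phi y.
Let phiD x y : phi (x + y) = phi x + phi y.
Proof. by have := phi_lin 1 x y; rewrite !scale1r. Qed.
Let phi0 : phi 0 = 0.
Proof. by apply: (addrI (phi 0)); rewrite -phiD !addr0. Qed.
Let phiZ c x : phi (c *: x) = c *: phi x.
Proof. by have := phi_lin c x 0; rewrite !addr0 phi0 addr0. Qed.

Definition ext_map (f : ext) : ext := [ffun k => phi (f k)].

Lemma ext_map_tens q l : ext_map (tens q l) = tens q (phi l).
Proof. by apply/ffunP => k; rewrite !ffunE phiZ. Qed.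
Lemma ext_mapD f g : ext_map (f + g) = ext_map f + ext_map g.
Proof. by apply/ffunP => k; rewrite !ffunE phiD. Qed.
Lemma ext_mapZ c f : ext_map (c *: f) = c *: ext_map f.
Proof. by apply/ffunP => k; rewrite !ffunE phiZ. Qed.
Lemma ext_map0 : ext_map 0 = 0.
Proof. by apply/ffunP => k; rewrite !ffunE phi0. Qed.
Lemma ext_map_sum I (r : seq I) (P : pred I) (F : I -> ext) :
  ext_map (\sum_(i <- r | P i) F i) = \sum_(i <- r | P i) ext_map (F i).
Proof. by apply: (big_morph ext_map) => [x y|]; rewrite ?ext_mapD ?ext_map0. Qed.
Lemma ext_map_pmul q f : ext_map (pmul q f) = pmul q (ext_map f).
Proof.
move: f; apply: ext_ind => [|f g hf hg|r l]; first by rewrite pmul0r ext_map0 pmul0r.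
  by rewrite pmulDr !ext_mapD hf hg pmulDr.
by rewrite pmul_tens !ext_map_tens pmul_tens.
Qed.
Lemma ext_map_br : (forall x y, phi (br x y) = br (phi x) (phi y)) ->
  forall f g, ext_map (ext_br f g) = ext_br (ext_map f) (ext_map g).
Proof.
move=> hphi; apply: ext_ind => [|f f' hf hf'|q l] g.
- by rewrite ext_br0l ext_map0 ext_br0l.
- by rewrite ext_brDl !ext_mapD hf hf' ext_brDl.
move: g; apply: ext_ind => [|g g' hg hg'|q' l'].
- by rewrite ext_br0r ext_map0 ext_br0r.
- by rewrite ext_brDr !ext_mapD hg hg' ext_brDr.
by rewrite ext_br_tens !ext_map_tens ext_br_tens hphi.
Qed.
End Functoriality.

Lemma ext_br_pmull q f g : ext_br (pmul q f) g = pmul q (ext_br f g).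
Proof.
move: f g; apply: ext_ind => [|f f' hf hf'|r l] g.
- by rewrite pmul0r ext_br0l pmul0r.
- by rewrite pmulDr !ext_brDl hf hf' pmulDr.
move: g; apply: ext_ind => [|g g' hg hg'|q' l'].
- by rewrite !ext_br0r pmul0r.
- by rewrite !ext_brDr hg hg' pmulDr.
by rewrite pmul_tens !ext_br_tens pmul_tens mulrA.
Qed.
Lemma ext_br_pmulr q f g : ext_br f (pmul q g) = pmul q (ext_br f g).
Proof. by rewrite ext_brC ext_br_pmull (ext_brC f g) -[in RHS]scaleN1r pmulZr scaleN1r. Qed.
End ScalarExtension.

(** * Cyclotomic polynomials over an arbitrary field *)

Section CyclotomicQuotient.
Variables (K : fieldType) (n : nat).
Hypothesis n_gt0 : (0 < n)%N.

(** The quotient by this polynomial need not be a field; the two divisibilities below let the class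
    of [X] serve as a primitive [n]-th root of unity. *)
Definition cyclotomic_over : {poly K} := map_poly intr 'Phi_n.

Lemma size_cyclotomic_over : size cyclotomic_over = (totient n).+1.
Proof.
rewrite size_map_poly_id0 ?size_Cyclotomic //.
by rewrite (monicP (Cyclotomic_monic n)) rmorph1 oner_neq0.
Qed.

(** Over the integers, X^(kn) - 1 is the product of the cyclotomic polynomials of the divisors of
    kn. Those dividing k form X^k - 1, and the geometric sum is the product of the others, among
    them that of index [n]. *)
Lemma dvdp_geometric_sum k : ~~ (n %| k)%N ->
  cyclotomic_over %| \sum_(j < n) 'X^(k * j).
Proof.
move=> nk; have k0 : (0 < k)%N by case: k nk; rewrite ?dvdn0.
have kn0 : (0 < k * n)%N by rewrite muln_gt0 k0.
have hk : 'X^k - 1 != 0 :> {poly int} by rewrite -size_poly_eq0 size_XnsubC.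
have [q hq] : exists q : {poly int}, \sum_(j < n) 'X^(k * j) = 'Phi_n * q.
  exists (\prod_(d <- rem n [seq d <- divisors (k * n) | ~~ (d %| k)%N]) 'Phi_d).
  apply: (mulfI hk).
  transitivity (('X^k - 1) * \prod_(d <- divisors (k * n) | ~~ (d %| k)%N) 'Phi_d); last first.
    rewrite -big_filter (big_rem n) //=.
    by rewrite mem_filter nk -dvdn_divisors ?muln_gt0 ?k0 // dvdn_mull.
  rewrite (eq_bigr (fun j : 'I_n => 'X^k ^+ j)) => [|j _]; last by rewrite exprM.
  rewrite -subrX1 -exprM -(prod_Cyclotomic kn0) -(prod_Cyclotomic k0).
  rewrite (bigID (fun d => d %| k)%N) /=; congr (_ * _).
  rewrite -big_filter; apply: perm_big; apply: uniq_perm.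
  - by rewrite filter_uniq // divisors_uniq.
  - exact: divisors_uniq.
  - move=> d; rewrite mem_filter -!dvdn_divisors ?muln_gt0 ?k0 //.
    by apply: andb_idr => h; apply: dvdn_mulr.
have -> : \sum_(j < n) 'X^(k * j) = map_poly intr (\sum_(j < n) 'X^(k * j)) :> {poly K}.
  by rewrite rmorph_sum; apply: eq_bigr => j _; rewrite /= map_polyXn.
by rewrite hq rmorphM dvdp_mulIl.
Qed.

Lemma dvdp_Xn_sub1 : cyclotomic_over %| 'X^n - 1.
Proof.
have -> : 'X^n - 1 = map_poly intr ('X^n - 1) :> {poly K}.
  by rewrite rmorphB rmorph1 /= map_polyXn.
by rewrite -prod_Cyclotomic // (big_rem n) ?divisors_id //= rmorphM dvdp_mulIl.
Qed.
End CyclotomicQuotient.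

(** * Eigenspaces of an automorphism of finite order *)

Section Eigenspaces.
Variables (K : fieldType) (L : lmodType K) (br : L -> L -> L).
Hypothesis lie : is_lie_bracket br.
Variable p : nat.
Let n := p.+2.
Hypothesis n_unit : n%:R != 0 :> K.
Variable psi : L -> L.
Hypothesis psi_lin : forall c x y, psi (c *: x + y) = c *: psi x + psi y.
Hypothesis psi_br : forall x y, psi (br x y) = br (psi x) (psi y).
Hypothesis psi_order : forall x, iter n psi x = x.
Hypothesis psi_free : forall x, psi x = x -> x = 0.

Let h := cyclotomic_over K n.
Let m := (totient n).-1.
Let size_h : size h = m.+2.
Proof. by rewrite size_cyclotomic_over prednK // totient_gt0. Qed.
Local Notation E := (ext L m).
Local Notation W q f := (@pmul K L h m q f).
Local Notation Psi := (@ext_map K L m psi).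

Definition eigenspace_ext (a : 'I_p.+2) (f : E) : Prop := Psi f = W 'X^a f.

Let pmul_Xmod i j (f : E) : i = j %[mod n] -> W 'X^i f = W 'X^j f.
Proof.
have red i' : W 'X^i' f = W 'X^(i' %% n) f.
  rewrite -{1}['X^i'](subrK 'X^(i' %% n)) pmulDl (pmul_dvd (q := _ - _)) ?add0r //.
  rewrite {1}(divn_eq i' n) exprD mulnC exprM -[X in _ - X]mul1r -mulrBl subrX1 -mulrA.
  by apply: dvdp_mulr; apply: dvdp_Xn_sub1.
by move=> e; rewrite red e -red.
Qed.

Let PsiW q f : Psi (W q f) = W q (Psi f).
Proof. exact: ext_map_pmul. Qed.

Let iter_Psi j (f : E) k : iter j Psi f k = iter j psi (f k).
Proof. by elim: j => //= j IH; rewrite ffunE IH. Qed.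

Lemma graded_eigenspace : graded (ext_br br h (m := m)) eigenspace_ext.
Proof.
split.
- move=> a; split=> [|c f g hf hg]; rewrite /eigenspace_ext.
    by rewrite pmul0r ext_map0.
  by rewrite pmulDr pmulZr -hf -hg ext_mapD // ext_mapZ.
- move=> a b f g hf hg; rewrite /eigenspace_ext (ext_map_br lie size_h psi_lin psi_br).
  rewrite hf hg (ext_br_pmull lie size_h) (ext_br_pmulr lie size_h) (pmulA size_h) -exprD.
  by apply: pmul_Xmod; rewrite /= modn_mod.
- move=> f; rewrite /eigenspace_ext expr0 (pmul1 size_h) => hf.
  apply/ffunP => k; rewrite ffunE; apply: psi_free.
  by rewrite -{2}hf ffunE.
Qed.

(** [n] times the projection to the eigenspace of X^a; [n - a] replaces the exponent -a. *)
Definition eigen_proj (a : 'I_p.+2) (f : E) : E :=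
  \sum_(j < n) W 'X^((n - a) * j) (iter j Psi f).

Lemma eigen_projP a f : eigenspace_ext a (eigen_proj a f).
Proof.
rewrite /eigenspace_ext /eigen_proj ext_map_sum // pmul_sumr.
pose T j := W 'X^((n - a) * j + a) (iter j Psi f).
have hn : ((n - a) + a = n)%N by rewrite subnK // ltnW.
transitivity (\sum_(j < n) T j.+1).
  apply: eq_bigr => j _; rewrite PsiW /T iterS; apply: pmul_Xmod.
  by rewrite mulnS addnAC hn modnDl.
transitivity (\sum_(j < n) T j); last first.
  by apply: eq_bigr => j _; rewrite (pmulA size_h) -exprD addnC.
rewrite big_ord_recr [RHS]big_ord_recl /= addrC; congr (_ + _).
rewrite /T muln0; have -> : iter n Psi f = f.
  by apply/ffunP => k; rewrite iter_Psi psi_order.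
by apply: pmul_Xmod; rewrite modnMDl.
Qed.

Let geom_sum k (f : E) : ~~ (n %| k)%N -> \sum_(j < n) W 'X^(k * j) f = 0.
Proof. by move=> nk; rewrite -pmul_suml pmul_dvd // dvdp_geometric_sum. Qed.

Lemma sum_eigen_proj f : \sum_a eigen_proj a f = n%:R *: f.
Proof.
rewrite exchange_big big_ord_recl /= [X in _ + X]big1 ?addr0 => [|j _].
  under eq_bigr do rewrite muln0 expr0 (pmul1 size_h).
  by rewrite sumr_const card_ord scaler_nat.
(* Reversal turns [n - a] into [a + 1], so for a fixed nonzero power of [Psi] the coefficients form
   a geometric sum. *)
rewrite (reindex_inj rev_ord_inj) /=.
set g := Psi _.
transitivity (\sum_(a < n) W 'X^(j.+1) (W 'X^(j.+1 * a) g)).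
  apply: eq_bigr => a _; rewrite (pmulA size_h) -exprD -mulnS mulnC.
  by congr (W 'X^(_ * _) g); rewrite /= /n; have := ltn_ord a; lia.
rewrite -pmul_sumr geom_sum ?pmul0r //.
by rewrite gtnNdvd //; have := ltn_ord j.
Qed.

Lemma eigen_proj_eigen a b f : eigenspace_ext b f ->
  eigen_proj a f = if a == b then n%:R *: f else 0.
Proof.
move=> hf; have hj j : iter j Psi f = W 'X^(b * j) f.
  elim: j => [|j IH]; first by rewrite muln0 expr0 (pmul1 size_h).
  by rewrite iterS IH PsiW hf (pmulA size_h) -exprD mulnS addnC.
rewrite /eigen_proj.
under eq_bigr do rewrite hj (pmulA size_h) -exprD -mulnDl.
case: eqP => [->|/eqP nab].
  have -> : (n - b + b = n)%N by rewrite subnK // ltnW.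
  rewrite (eq_bigr (fun=> f)) ?sumr_const ?card_ord ?scaler_nat // => j _.
  by rewrite (@pmul_Xmod _ 0) ?expr0 ?(pmul1 size_h) // modnMr mod0n.
apply: geom_sum; apply: contra nab => /dvdnP [k ek]; apply/eqP/val_inj => /=.
have := ltn_ord a; have := ltn_ord b; move: ek; rewrite /n.
case: k => [|[|k]]; lia.
Qed.

Let ext0_of_n (f : E) : n%:R *: f = 0 -> f = 0.
Proof. by move=> /eqP; rewrite scaler_eq0 (negPf n_unit) => /eqP. Qed.

Lemma eigenspaces_span f : span_of (fun g => exists a, eigenspace_ext a g) f.
Proof.
rewrite -[f]scale1r -(mulVf n_unit) -scalerA -sum_eigen_proj; apply: span_scale.
apply: (big_ind (span_of _)) => [||a _].
- exact: span_0.
- exact: span_add.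
- by apply: span_gen; exists a; apply: eigen_projP.
Qed.

Lemma eigenspaces_direct (I : finType) (dg : I -> 'I_p.+2) (f : I -> E) (a : 'I_p.+2) :
  (forall i, eigenspace_ext (dg i) (f i)) -> \sum_i f i = 0 ->
  \sum_(i | dg i == a) f i = 0.
Proof.
move=> hf h0.
have projD g g' : eigen_proj a (g + g') = eigen_proj a g + eigen_proj a g'.
  rewrite /eigen_proj -big_split; apply: eq_bigr => j _.
  rewrite /= -pmulDr; congr (pmul _ _ _); apply/ffunP => k; rewrite !ffunE !iter_Psi ffunE.
  elim: {k}(nat_of_ord j) (g k) (g' k) => //= j' IH u v; rewrite IH.
  by have := psi_lin 1 (iter j' psi u) (iter j' psi v); rewrite !scale1r.
have proj0 : eigen_proj a 0 = 0 by apply: (addrI (eigen_proj a 0)); rewrite -projD !addr0.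
apply: ext0_of_n; rewrite scaler_sumr big_mkcond /=.
transitivity (eigen_proj a (\sum_i f i)); last by rewrite h0 proj0.
rewrite (big_morph _ projD proj0); apply: eq_bigr => i _.
by rewrite (eigen_proj_eigen a (hf i)) eq_sym.
Qed.

(** * The involution and the selective relation *)

Section Involution.
Variable eta : L -> L.
Hypothesis eta_lin : forall c x y, eta (c *: x + y) = c *: eta x + eta y.
Hypothesis eta_inv : forall x, eta (eta x) = x.
Hypothesis eta_psi : forall x, psi (eta (psi x)) = eta x.
Hypothesis eta_metabelian : forall x y z v, eta x = x -> eta y = y -> eta z = z ->
  eta v = v -> br (br x y) (br z v) = 0.
Hypothesis odd_n : odd p.+2.
Local Notation Eta := (@ext_map K L m eta).
Local Notation brE := (ext_br br h (m := m)).

(** Applying psi eta psi = eta to an eigenvector gives X^a Psi (Eta f) = Eta f, and X^a is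
    invertible. *)
Lemma ext_map_eigenspace a f : eigenspace_ext a f -> eigenspace_ext (- a) (Eta f).
Proof.
rewrite /eigenspace_ext => hf.
have e1 : W 'X^a (Psi (Eta f)) = Eta f.
  rewrite -PsiW -(ext_map_pmul size_h eta_lin) -hf.
  by apply/ffunP => k; rewrite !ffunE eta_psi.
transitivity (W 'X^0 (Psi (Eta f))); first by rewrite expr0 (pmul1 size_h).
rewrite -[in RHS]e1 (pmulA size_h) -exprD.
by apply: pmul_Xmod; rewrite /= modnDml subnK ?modnn ?mod0n // ltnW.
Qed.

(** Fixed points of [Eta] are spanned by pure tensors of fixed points of [eta], so multilinearity
    reduces to the hypothesis on [L]. *)
Let fixed_metabelian f g k l : Eta f = f -> Eta g = g -> Eta k = k -> Eta l = l ->
  brE (brE f g) (brE k l) = 0.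
Proof.
move=> hf hg hk hl.
have fx (u : E) : Eta u = u -> forall i, eta (u i) = u i.
  by move=> hu i; rewrite -{2}hu ffunE.
have lieE := ext_is_lie lie size_h.
pose S (u : E) := exists q l', u = tens h m q l' /\ eta l' = l'.
have sp u : Eta u = u -> span_of S u.
  move=> hu; rewrite (tens_decomp size_h u); apply: (big_ind (span_of S)) => [||i _].
  - exact: span_0.
  - exact: span_add.
  - by apply: span_gen; exists 'X^i, (u i); rewrite fx.
have lin := (brDl lieE, brDr lieE, brZl lieE, brZr lieE).
have lin0 := (br0l lieE, br0r lieE).
apply: (span_sub (T := fun f => brE (brE f g) (brE k l) = 0) _ _ (sp _ hf)) => [|_ [q1 [l1 [-> e1]]]].
  by split=> [|c x y hx hy]; rewrite ?lin ?lin0 ?hx ?hy ?scaler0 ?addr0.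
apply: (span_sub (T := fun g => brE (brE _ g) (brE k l) = 0) _ _ (sp _ hg)) => [|_ [q2 [l2 [-> e2]]]].
  by split=> [|c x y hx hy]; rewrite ?lin ?lin0 ?hx ?hy ?scaler0 ?addr0.
apply: (span_sub (T := fun k => brE _ (brE k l) = 0) _ _ (sp _ hk)) => [|_ [q3 [l3 [-> e3]]]].
  by split=> [|c x y hx hy]; rewrite ?lin ?lin0 ?hx ?hy ?scaler0 ?addr0.
apply: (span_sub (T := fun l => brE _ (brE _ l) = 0) _ _ (sp _ hl)) => [|_ [q4 [l4 [-> e4]]]].
  by split=> [|c x y hx hy]; rewrite ?lin ?lin0 ?hx ?hy ?scaler0 ?addr0.
by rewrite !(ext_br_tens lie size_h) eta_metabelian // tens0r.
Qed.

Let EtaEta f : Eta (Eta f) = f.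
Proof. by apply/ffunP => k; rewrite !ffunE eta_inv. Qed.

(** The elements f + Eta f are fixed. Expanding the vanishing product of four of them gives sixteen
    terms of degrees ±a ±b ±c ±d. Any term other than the all-plus one differs from it in degree by
    twice a nonempty subsum, which is nonzero, so the all-plus term is isolated. *)
Lemma ext_selective : selective brE eigenspace_ext.
Proof.
have lieE := ext_is_lie lie size_h; have hM := graded_eigenspace.
have lin := (brDl lieE, brDr lieE).
move=> a b c d x y z v hx hy hz hv [n15 n14 n13 n12 n11] [n10 n9 n8 n7 n6] n5.
have z0 u f : u = 0 -> eigenspace_ext u f -> f = 0 by move=> ->; apply: (graded_0 hM).
have [/z0/(_ hx) ->|n4] := eqVneq a 0; first by rewrite !(br0l lieE).
have [/z0/(_ hy) ->|n3] := eqVneq b 0; first by rewrite (br0r lieE) (br0l lieE).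
have [/z0/(_ hz) ->|n2] := eqVneq c 0; first by rewrite (br0l lieE) (br0r lieE).
have [/z0/(_ hv) ->|n1] := eqVneq d 0; first by rewrite !(br0r lieE).
pose sg (s : bool) (u : 'I_p.+2) := if s then u else - u.
pose cp (s : bool) (f : E) := if s then f else Eta f.
have cpP s u f : eigenspace_ext u f -> eigenspace_ext (sg s u) (cp s f).
  by case: s => //; apply: ext_map_eigenspace.
pose dg (s : bool * bool * bool * bool) :=
  sg s.1.1.1 a + sg s.1.1.2 b + (sg s.1.2 c + sg s.2 d).
pose F (s : bool * bool * bool * bool) :=
  brE (brE (cp s.1.1.1 x) (cp s.1.1.2 y)) (brE (cp s.1.2 z) (cp s.2 v)).
have hF s : eigenspace_ext (dg s) (F s).
  by do !apply: (graded_br hM); apply: cpP.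
have sumF : \sum_s F s = 0.
  have fixed_cp f : Eta (f + Eta f) = f + Eta f by rewrite ext_mapD // EtaEta addrC.
  have sum_prod (I J : finType) (G : I * J -> E) : \sum_u G u = \sum_i \sum_j G (i, j).
    by rewrite pair_bigA; apply: eq_bigr => -[].
  apply: etrans (fixed_metabelian (fixed_cp x) (fixed_cp y) (fixed_cp z) (fixed_cp v)).
  rewrite !sum_prod.
  transitivity (\sum_s1 brE (brE (cp s1 x) (y + Eta y)) (brE (z + Eta z) (v + Eta v)));
    last by rewrite big_bool /cp /= -!(brDl lieE).
  apply: eq_bigr => s1 _.
  transitivity (\sum_s2 brE (brE (cp s1 x) (cp s2 y)) (brE (z + Eta z) (v + Eta v)));
    last by rewrite big_bool /cp /= -!(brDl lieE) -!(brDr lieE).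
  apply: eq_bigr => s2 _.
  transitivity (\sum_s3 brE (brE (cp s1 x) (cp s2 y)) (brE (cp s3 z) (v + Eta v)));
    last by rewrite big_bool /cp /= -!(brDr lieE) -!(brDl lieE).
  apply: eq_bigr => s3 _.
  by rewrite big_bool /F /cp /= -!(brDr lieE).
have := eigenspaces_direct (a + b + (c + d)) hF sumF.
rewrite (big_pred1 (true, true, true, true)) //= => s.
have key u : u != 0 -> (a + b + (c + d) - (u + u) == a + b + (c + d)) = false.
  move=> nu; apply/negP; rewrite -subr_eq0 addrAC subrr add0r oppr_eq0 => /eqP.
  by move/(Zp_double_eq0 odd_n)/eqP; rewrite (negPf nu).
case: s => [[[[] []] []] []]; rewrite /dg /sg /=; first by rewrite !eqxx.
- by apply: etrans (key _ n1); congr (_ == _); ring.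
- by apply: etrans (key _ n2); congr (_ == _); ring.
- by apply: etrans (key _ n5); congr (_ == _); ring.
- by apply: etrans (key _ n3); congr (_ == _); ring.
- by apply: etrans (key _ n6); congr (_ == _); ring.
- by apply: etrans (key _ n7); congr (_ == _); ring.
- by apply: etrans (key _ n11); congr (_ == _); ring.
- by apply: etrans (key _ n4); congr (_ == _); ring.
- by apply: etrans (key _ n8); congr (_ == _); ring.
- by apply: etrans (key _ n9); congr (_ == _); ring.
- by apply: etrans (key _ n12); congr (_ == _); ring.
- by apply: etrans (key _ n10); congr (_ == _); ring.
- by apply: etrans (key _ n13); congr (_ == _); ring.
- by apply: etrans (key _ n14); congr (_ == _); ring.
- by apply: etrans (key _ n15); congr (_ == _); ring.
Qed.
Lemma derived_ext i l : derived br (fun=> True) i l ->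
  span_of (fun f => exists a, iter i (der brE (A := 'I_p.+2)) eigenspace_ext a f)
    (tens h m 1 l).
Proof.
have lieE := ext_is_lie lie size_h.
elim: i l => [|i IH] l /= => [_|]; first exact: eigenspaces_span.
apply: (span_sub (T := fun l => span_of _ (tens h m 1 l))).
  split=> [|c x y hx hy]; first by rewrite tens0r; apply: span_0.
  by rewrite tensDr tensZr; apply: span_add => //; apply: span_scale.
move=> _ [x [y [/IH hx [/IH hy ->]]]].
rewrite -[1]mulr1 -(ext_br_tens lie size_h).
apply: (span_sub (T := fun f => span_of _ (brE f _)) _ _ hx) => [|f [a hf]].
  split=> [|c u v hu hv]; first by rewrite (br0l lieE); apply: span_0.
  by rewrite (brDl lieE) (brZl lieE); apply: span_add => //; apply: span_scale.
apply: (span_sub (T := fun g => span_of _ (brE f g)) _ _ hy) => [|g [b hg]].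
  split=> [|c u v hu hv]; first by rewrite (br0r lieE); apply: span_0.
  by rewrite (brDr lieE) (brZr lieE); apply: span_add => //; apply: span_scale.
apply: span_gen; exists (a + b); apply: span_gen; exists a, f, g; split=> //; split=> //.
by rewrite addrAC subrr add0r.
Qed.

Lemma derived_eq0 s l : separating 'I_p.+2 s ->
  derived br (fun=> True) (2 ^ s).+1 l -> l = 0.
Proof.
move=> hsep /derived_ext hl.
have lieE := ext_is_lie lie size_h.
have h2 : forall x : 'I_p.+2, x + x = 0 -> x = 0 by exact: Zp_double_eq0.
have : tens h m 1 l = 0.
  apply: (span_sub (T := fun f => f = 0) _ _ hl) => [|f [a]].
    by split=> [|c u v -> ->]; rewrite ?scaler0 ?addr0.
  exact: (selective_der lieE h2 graded_eigenspace ext_selective hsep).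
(* The coordinate at index 0 of the tensor of 1 with [l] is [l] itself. *)
move=> /ffunP/(_ ord0); rewrite !ffunE modp_small ?size_poly1 ?size_h //.
by rewrite coef1 scale1r.
Qed.
End Involution.
End Eigenspaces.

(* As [T^n = 1] with [n] a power of the characteristic, [(T - 1)^n = T^n - 1 = 0]. *)
Lemma unipotent_fixed_point (K : fieldType) (L : lmodType K) (T : L -> L)
    (V : L -> Prop) (n : nat) :
  (forall c x y, T (c *: x + y) = c *: T x + T y) ->
  (forall x, V x -> V (T x - x)) ->
  [pchar K].-nat n -> (forall x, iter n T x = x) ->
  (forall x, V x -> T x = x -> x = 0) -> forall x, V x -> x = 0.
Proof.
move=> Tlin hV hn Tn hfix x Vx.
have T0 : T 0 = 0.
  by have := Tlin (-1) 0 0; rewrite scaler0 addr0 scaleN1r => {1}->; rewrite addNr.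
have TD u v : T (u + v) = T u + T v by have := Tlin 1 u v; rewrite !scale1r.
have TZ c u : T (c *: u) = c *: T u by have := Tlin c u 0; rewrite !addr0 T0 addr0.
(* [act m P] is P(T) x as soon as [m] bounds the size of [P]. *)
pose act m (P : {poly K}) := \sum_(i < m) P`_i *: iter i T x.
pose D u := T u - u.
have actE m (P : {poly K}) : (size P <= m)%N -> act m.+1 (P * ('X - 1)) = D (act m P).
  move=> hP; rewrite /D /act (big_morph T TD T0).
  transitivity (\sum_(i < m.+1) (P * 'X)`_i *: iter i T x - \sum_(i < m.+1) P`_i *: iter i T x).
    rewrite -sumrB; apply: eq_bigr => i _.
    by rewrite mulrBr mulr1 coefB scalerBl.
  congr (_ - _).
    rewrite big_ord_recl coefMX scale0r add0r; apply: eq_bigr => i _.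
    by rewrite coefMX TZ.
  by rewrite big_ord_recr /= nth_default // scale0r addr0.
have iterD j : iter j D x = act j.+1 (('X - 1) ^+ j).
  elim: j => [|j IH]; first by rewrite /act big_ord1 expr0 coef1 scale1r.
  by rewrite iterS IH -actE ?exprSr // size_exp_XsubC.
have Dn : iter n D x = 0.
  rewrite iterD; have -> : ('X - 1) ^+ n = 'X^n - 1 :> {poly K}.
    have hn' : [pchar {poly K}].-nat n by rewrite (eq_pnat _ (pchar_poly K)).
    by apply/eqP; rewrite -subr_eq opprK -[X in _ + X](expr1n _ n) -exprDn_pchar // subrK.
  transitivity (\sum_(i < n.+1) ('X^n)`_i *: iter i T x - \sum_(i < n.+1) (1 : {poly K})`_i *: iter i T x).
    by rewrite -sumrB; apply: eq_bigr => i _; rewrite coefB scalerBl.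
  rewrite big_ord_recr [X in _ - X]big_ord_recl /= !big1 => [|i _|i _].
  - by rewrite coefXn coef1 !eqxx !scale1r Tn add0r addr0 subrr.
  - by rewrite coef1 scale0r.
  - by rewrite coefXn ltn_eqF ?scale0r.
have nil j u : V u -> iter j D u = 0 -> u = 0.
  elim: j u => [|j IH] u Vu //; rewrite iterSr => /(IH _ (hV _ Vu)).
  by move/eqP; rewrite subr_eq0 => /eqP; apply: hfix.
exact: nil Dn.
Qed.

(** As [F] is abelian and y has order 2, x * x^y is centralized by y, hence trivial in a Frobenius
    group. *)
Lemma Frobenius_involution_inverts (gT : finGroupType) (G F H : {group gT}) x y :
  [Frobenius G = F ><| H]%g -> abelian F -> #|H| = 2%N -> x \in F -> y \in H ->
  y != 1%g -> (x ^ y = x^-1)%g.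
Proof.
move=> frob abF H2 xF yH ny.
have /sdprodP[_ _ nFH _] : (F ><| H = G)%g by case/Frobenius_context: frob.
have y2 : (y * y = 1)%g.
  by apply/eqP; rewrite -expg2 -order_dvdn -H2 order_dvdG.
have xyF : (x ^ y \in F)%g by rewrite memJ_norm // (subsetP nFH).
have : (x * x ^ y \in 'C_F[y])%g.
  rewrite inE groupM //= ; apply/cent1P; apply/commgP; apply/conjg_fixP.
  rewrite conjMg -conjgM y2 conjg1; exact: (centsP abF).
have yH1 : y \in H^#%g by rewrite !inE ny.
rewrite (Frobenius_reg_ker frob yH1) => /set1gP e.
by apply/eqP; rewrite eq_sym eq_invg_mul e.
Qed.

Theorem theorem1 :
  exists C : nat,
  forall (K : fieldType) (L : lmodType K) (br : L -> L -> L)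
         (gT : finGroupType) (G F H : {group gT}) (rho : gT -> L -> L),
    is_lie_bracket br ->
    lie_aut_action br G rho ->
    [Frobenius G = F ><| H]%g ->
    cyclic F ->
    #|H| = 2%N ->
    (forall l : L, fixed_pts rho F l -> l = 0) ->
    (forall l : L, derived br (fixed_pts rho H) 2 l -> l = 0) ->
    forall l : L, derived br (fun _ => True) C l -> l = 0.
Proof.
have [s hs] := odd_separating; exists (2 ^ s).+1.
move=> K L br gT G F H rho lie [rho_lin rho_br rho1 rhoM _] frob cycF H2 fixF metH l.
have /sdprodP[_ defG nFH _] : (F ><| H = G)%g by case/Frobenius_context: frob.
have sFG : F \subset G by rewrite -defG mulG_subl.
have sHG : H \subset G by rewrite -defG mulG_subr.
have [phi defF] := cyclicP cycF.
have phiF : phi \in F by rewrite defF cycle_id.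
have phiX u i x : u \in G -> iter i (rho u) x = rho (u ^+ i)%g x.
  move=> uG; elim: i => [|i IH]; first by rewrite expg0 rho1.
  by rewrite iterS IH expgSr rhoM // groupX.
pose pi := [pchar K] : nat_pred.
(* The parts of the generator of order prime to the characteristic and of order a power of it; in
   characteristic 0 the latter is trivial. *)
set psi := (phi.`_pi^')%g; set u := (phi.`_pi)%g.
have psiF : psi \in F by rewrite defF cycle_constt.
have uF : u \in F by rewrite defF cycle_constt.
have psiG := subsetP sFG _ psiF; have uG := subsetP sFG _ uF.
have psi_u : commute psi u by apply: (centsP (cyclic_abelian cycF)).
(* [u] acts on the fixed points of [psi] with order a power of the characteristic, and a common
   fixed point of [u] and [psi] is fixed by all of [F]. *)
have fix_psi x : rho psi x = x -> x = 0.
  apply: (@unipotent_fixed_point _ _ (rho u) (fun x => rho psi x = x) #[u]%g).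
  - exact: rho_lin.
  - move=> {}x hx; rewrite -scaleN1r addrC rho_lin // hx; congr (_ + _).
    by rewrite -!rhoM // -psi_u rhoM // hx.
  - by rewrite /u order_constt part_pnat.
  - by move=> {}x; rewrite phiX // expg_order rho1.
  - move=> {}x hx hu; apply: fixF => g; rewrite defF => /cycleP[i ->].
    rewrite -phiX ?(subsetP sFG) //; elim: i => //= i ->.
    by rewrite -(consttC pi phi) rhoM // -/u -/psi hu.
have n_unit : #[psi]%g%:R != 0 :> K by rewrite natf_neq0_pchar /psi order_constt part_pnat.
have odd_F : odd #|F|.
  by have := Frobenius_coprime frob; rewrite H2 coprimen2.
have odd_n : odd #[psi]%g by apply: dvdn_odd odd_F; apply: order_dvdG.
have [y yH ny] : exists2 y, y \in H & y != 1%g.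
  by apply/trivgPn; rewrite -cardG_gt1 H2.
have yG := subsetP sHG _ yH.
have y2 : (y * y = 1)%g by apply/eqP; rewrite -expg2 -order_dvdn -H2 order_dvdG.
have defH g : g \in H -> g = 1%g \/ g = y.
  move=> gH; have [->|ng] := eqVneq g 1%g; [by left|right].
  apply/eqP; apply: contraLR (leqnn #|H|) => ngy; rewrite -ltnNge {1}H2.
  have sub : [set 1%g; g; y] \subset H.
    by apply/subsetP => z; rewrite !inE => /orP[/orP[]|] /eqP-> //.
  apply: leq_trans (subset_leq_card sub).
  by rewrite -setUA cardsU1 cards2 !inE ![1%g == _]eq_sym (negPf ng) (negPf ny) (negPf ngy).
have psi_y : (psi * y * psi = y)%g.
  have := Frobenius_involution_inverts frob (cyclic_abelian cycF) H2 psiF yH ny.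
  by move=> e; rewrite -[(psi * y)%g](mulKVg y) -conjgE e -mulgA mulVg mulg1.
(* The grading requires order at least 2; if [psi] is trivial, every element is fixed by it and thus
   zero. *)
case en : #[psi]%g (order_gt0 psi) odd_n n_unit => [|[|p]] // _ odd_n n_unit.
  move=> _; apply: fix_psi.
  by move/eqP: en; rewrite order_eq1 => /eqP ->; rewrite rho1.
apply: (derived_eq0 lie n_unit (rho_lin _ psiG) (rho_br _ psiG) _ fix_psi
  (rho_lin _ yG) _ _ _ odd_n (hs _ odd_n)).
- by move=> x; rewrite -en phiX // expg_order rho1.
- by move=> x; rewrite -rhoM // y2 rho1.
- by move=> x; rewrite -!rhoM ?groupM // mulgA psi_y.
- move=> x1 x2 x3 x4 h1 h2 h3 h4; apply: metH.
  have fx x : rho y x = x -> fixed_pts rho H x.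
    by move=> hx g /defH[] ->.
  apply: span_gen; exists (br x1 x2), (br x3 x4); split; [|split=> //]; apply: span_gen.
    by exists x1, x2; split; [exact: fx|split=> //; exact: fx].
  by exists x3, x4; split; [exact: fx|split=> //; exact: fx].
Qed.
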